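(* Let $N\ge2$, $1\le M<N$, $\gcd(M,N)=1$, $L\ge3$. For every output label $\eta\in\mathbb Z_{2N}$, every $r\in\mathbb Z$ and each branch $\sigma\in\{+,-\}$, the operator $\mathcal B_{\eta,r}^{\sigma}$ defined in the context is an antiunitary symmetry of the same-branch Hamiltonian: it is antiunitary and $\mathcal B_{\eta,r}^{\sigma}H_\eta^\sigma(M;0)(\mathcal B_{\eta,r}^{\sigma})^{-1}=H_\eta^\sigma(M;0)$. If the $Q$-sector with $Q=\omega^m$ is labelled by $m\in\mathbb Z_N$, then $\mathcal B_{\eta,r}^\sigma$ maps sector $m$ to sector $$m\longmapsto c_\eta^\sigma-m\pmod N,\qquad c_\eta^+=2L+1-\kappa_\eta,\qquad c_\eta^-=-1-\kappa_\eta.$$ Consequently, for every $m$ with $m\not\equiv c^\sigma_\eta-m\pmod N$, the restrictions of $H_\eta^\sigma(M;0)$ to the sectors $m$ and $c_\eta^\sigma-m$ have exactly the same spectrum, including multiplicities.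
   Context: Parameters: $\varepsilon=e^{i\pi/N}$, $q=\varepsilon^M$, $\omega=q^2$, $f_\eta=\varepsilon^\eta$. Endpoint space $\mathbb C^N_a$ with basis $|1\rangle,\dots,|N\rangle$ (indices mod $N$): $Z|n\rangle=\omega^n|n\rangle$, $X|n\rangle=|n+1\rangle$; $Y_{m,n}=X^mZ^n$. A physical site is $\mathbb C^2$ with basis $|0\rangle,|1\rangle$; $\sigma^+=|0\rangle\langle1|$, $\sigma^-=|1\rangle\langle0|$, $\sigma^z=\operatorname{diag}(1,-1)$, $\sigma^x=\sigma^++\sigma^-$. Gates on $\mathbb C^2\otimes\mathbb C^N_a$ (the $(r,s)$ block multiplies $|r\rangle\langle s|$): $W_\sigma=L_\sigma/\sqrt2$, $$L_+=\begin{pmatrix}I&\omega X^{-1}\\ -qXZ&qZ\end{pmatrix},\qquad L_-=\begin{pmatrix}qZ&-qX^{-1}Z\\ X&\omega I\end{pmatrix}.$$ Bond density: $h_{j,j+1}=q\sigma_j^+\sigma_{j+1}^-+q^{-1}\sigma_j^-\sigma_{j+1}^++\frac{q+q^{-1}}4\sigma_j^z\sigma_{j+1}^z$. In the two-spin basis $|0\rangle=|00\rangle,|1\rangle=|01\rangle,|2\rangle=|10\rangle,|3\rangle=|11\rangle$ with $E_{rc}=|r\rangle\langle c|$ (tensor signs omitted), operators on $\mathbb C^2_A\otimes\mathbb C^2_B\otimes\mathbb C^N_a$: $$\begin{aligned}S_+=\tfrac12\bigl[&-E_{01}Y_{-1,-1}+q^3E_{02}Y_{-1,0}-q^4E_{03}Y_{-2,-1}-q^2E_{10}Y_{1,1}+q^2E_{12}Y_{0,1}-qE_{13}Y_{-1,0}\\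 &+q^{-3}E_{20}Y_{1,0}+q^{-2}E_{21}Y_{0,-1}+q^2E_{23}Y_{-1,-1}-E_{30}Y_{2,1}-q^{-1}E_{31}Y_{1,0}+E_{32}Y_{1,1}\bigr],\\ S_-=\tfrac12\bigl[&E_{01}Y_{-1,1}-qE_{02}Y_{-1,0}-E_{03}Y_{-2,1}+q^{-2}E_{10}Y_{1,-1}+q^2E_{12}Y_{0,-1}+q^3E_{13}Y_{-1,0}\\ &-q^{-1}E_{20}Y_{1,0}+q^{-2}E_{21}Y_{0,1}-q^{-2}E_{23}Y_{-1,1}-q^{-4}E_{30}Y_{2,-1}+q^{-3}E_{31}Y_{1,0}-E_{32}Y_{1,-1}\bigr].\end{aligned}$$ Output normalization: $F_+^{(\eta)}=\operatorname{diag}(1,f_\eta)$, $F_-^{(\eta)}=\operatorname{diag}(f_\eta,1)$, $W_\sigma^{(\eta)}=F_\sigma^{(\eta)}W_\sigma$ ($F$ on the physical factor), $S^{(\eta)}_{\sigma,ABa}=F^{(\eta)}_{\sigma,B}S_{\sigma,ABa}F^{(\eta)\dagger}_{\sigma,B}$ ($F$ on the second physical site $B$). Ring: sites $0,\dots,L-1$ labelled by $\mathbb Z_L$, Hilbert space $(\mathbb C^2)^{\otimes L}\otimes\mathbb C^N_a$, $H_\eta^\sigma(M;k)=\sum_{j\ne k-1}h_{j,j+1}+S^{(\eta)}_{\sigma,k-1,k,a}$; the reference seam position is $k=0$ (seam on $(L-1,0)$). Charge: $Q=g^{\otimes L}\otimes Z_a^{-1}$, $g=\operatorname{diag}(1,\omega)$;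 $Q$ commutes with $H^\sigma_\eta(M;k)$. Symmetry operators. $T$: translation of physical sites, $TO_jT^\dagger=O_{j+1}$, trivial on the endpoint; $\mathcal M_{\eta,+}=G_{+,0}^{(\eta)}T$, where $G_{+,0}^{(\eta)}$ is $W_+^{(\eta)}$ on site $0$ and the endpoint. $R$: site reflection, $RO_jR=O_{L-1-j}$, trivial on the endpoint. $J|n\rangle=|-n\bmod N\rangle$ on the endpoint. $\mathcal K_{z,a}$: coefficientwise complex conjugation in the product basis (physical $\sigma^z$ basis times endpoint basis). $\kappa_\eta\in\{0,\dots,N-1\}$ is determined by $M\kappa_\eta\equiv-\eta\pmod N$. $\delta=N\bmod 2\in\{0,1\}$. $P_N|n\rangle=p_n|n\rangle$ with $p_1=1$, $p_{n+1}=q^{1-\delta}\omega^np_n$ (this is consistent cyclically: $p_{N+1}=p_1$). For real $t$, $q^{t\sigma^z/2}:=\operatorname{diag}(e^{i\pi Mt/(2N)},e^{-i\pi Mt/(2N)})$. Then $$C_0=\Bigl(\bigotimes_{j=0}^{L-1}q^{(2L-\delta-2j)\sigma_j^z/2}\otimes X^{-L-1}P_N\Bigr)R,\quad \mathcal C_\eta=\bigl((F_+^{(\eta)})^{\otimes L}\otimes I_a\bigr)C_0,$$ $$\Theta_\eta=\bigl[(\sigma^x)^{\otimes L}\otimes X^{\kappa_\eta}J\bigr]\mathcal K_{z,a},\quad \mathcal A_\eta=\mathcal C_\eta\Theta_\eta,\quad \mathcal B_{\eta,r}^+=\mathcal M_{\eta,+}^{\,r}\mathcal A_\eta,\quad \mathcal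 B_{\eta,r}^-=\mathcal C_\eta^\dagger\mathcal B_{\eta,r}^+\mathcal C_\eta.$$ *)

(* Defs.v *)
From HB Require Import structures.
From mathcomp Require Import all_boot all_order all_algebra.
From mathcomp Require Import complex.
From mathcomp Require Import classical_sets reals trigo.

Set Implicit Arguments.
Unset Strict Implicit.
Unset Printing Implicit Defensive.

Import Order.TTheory GRing.Theory Num.Theory.
Local Open Scope ring_scope.

Variant branch := Plus | Minus.

(* Integer powers of an endomorphism; (f^-1)%VF is the inverse of f as soon as
   f is bijective. *)
Definition lfun_exp (F : fieldType) (V : vectType F) (f : 'End(V)) (r : int)
    : 'End(V) :=
  match r with
  | Posz n => iter n (fun g => (f \o g)%VF) \1%VF
  | Negz n => iter n.+1 (fun g => (f^-1 \o g)%VF) \1%VF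
  end.

(* The restriction of f to U, for U stable under f. *)
Definition lrestrict (F : fieldType) (V : vectType F) (U : {vspace V})
    (f : 'End(V)) : 'End(subvs_of U) :=
  (linfun (vsproj U) \o f \o linfun vsval)%VF.

(* Does not depend on the basis; its roots, with multiplicities, are the
   spectrum of f. *)
Definition lchar_poly (F : fieldType) (V : vectType F) (f : 'End(V))
    : {poly F} :=
  char_poly (passmx.mxof (vbasis {:V}) (vbasis {:V}) f).

Section Model.
Variables (R : realType) (N M : nat).
Local Notation C := R[i].

Definition cis (t : R) : C := Complex (cos t) (sin t).

Definition eps : C := cis (pi / N%:R).
Definition q : C := eps ^+ M.
Definition omega : C := q ^+ 2.
(* eps ^+ (2 * N) = 1, so the exponent only matters modulo 2 * N. *)
Definition feta (eta : 'Z_(2 * N)) : C := eps ^+ eta.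
Definition delta : nat := N %% 2.

(* The unique solution of M * k = - eta modulo N when M and N are coprime. *)
Definition kappa (eta : 'Z_(2 * N)) : 'Z_N :=
  odflt 0 [pick k : 'Z_N | M%:R * k == - (nat_of_ord eta)%:R].

(* Endpoint operators: the basis vector |n> is indexed by the class of n in
   'Z_N, and the (m, n) entry of a matrix y is <m|y|n>. *)
Local Notation endM := 'M[C]_((Zp_trunc N).+2).

Definition X : endM := \matrix_(m, n) (m == n + 1 :> 'Z_N)%:R.
Definition Z : endM := \matrix_(m, n) ((m == n)%:R * omega ^+ n).
Definition Y (a b : int) : endM := X ^ a * Z ^ b.
Definition J : endM := \matrix_(m, n) (m == - n :> 'Z_N)%:R.

(* phase k is p_(k+1). *)
Fixpoint phase (k : nat) : C :=
  if k is k'.+1 then q ^+ (1 - delta) * omega ^+ k * phase k' else 1.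

(* The entry at n is p_r, where r is the representative of n in 1, ..., N;
   thus r - 1 is the representative of n - 1 in 0, ..., N - 1. *)
Definition P : endM :=
  \matrix_(m, n) ((m == n)%:R * phase (n - 1 : 'Z_N)%R).

(* One-site operators: the (r, s) entry is the coefficient of |r><s|. *)
Definition sigp : 'M[C]_2 := delta_mx 0 1.
Definition sigm : 'M[C]_2 := delta_mx 1 0.
Definition diag2 (a b : C) : 'M[C]_2 :=
  diag_mx (\row_(i < 2) if i == 0 then a else b).
Definition sigz : 'M[C]_2 := diag2 1 (-1).
Definition sigx : 'M[C]_2 := sigp + sigm.
Definition gmx : 'M[C]_2 := diag2 1 omega.
Definition Fout (s : branch) (eta : 'Z_(2 * N)) : 'M[C]_2 :=
  match s with
  | Plus => diag2 1 (feta eta)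
  | Minus => diag2 (feta eta) 1
  end.
(* q^(t sigma^z / 2) *)
Definition qsz (t : R) : 'M[C]_2 :=
  diag2 (cis (pi * M%:R * t / (2 * N%:R))) (cis (- (pi * M%:R * t / (2 * N%:R)))).

(* The endpoint blocks of the gate L_+. *)
Definition Lplus (r s : 'I_2) : endM :=
  if r == 0 then (if s == 0 then 1 else omega *: X ^ (-1))
  else (if s == 0 then (- q) *: (X * Z) else q *: Z).

Section Chain.
Variable L : nat.

(* (C^2)^(tensor L) (x) C^N as the space of coefficient families over the
   product basis. *)
Definition config : finType := ({ffun 'Z_L -> 'I_2} * 'Z_N)%type.
Definition hilb : vectType C := {ffun config -> C^o}.

Definition ket (b : config) : hilb := [ffun c => (c == b)%:R].
Definition inner (u v : hilb) : C := \sum_b (u b)^* * v b.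

(* The operator with matrix elements a b c = <b|a|c>. *)
Definition mxop (a : config -> config -> C) : 'End(hilb) :=
  linfun (fun v : hilb => [ffun b => \sum_c a b c * v c] : hilb).

Definition adj (A : 'End(hilb)) : 'End(hilb) :=
  mxop (fun b c => (A (ket b) c)^*).

(* (a_0 (x) ... (x) a_(L-1)) (x) y *)
Definition tensor (a : 'Z_L -> 'M[C]_2) (y : endM) : 'End(hilb) :=
  mxop (fun b c => (\prod_j a j (b.1 j) (c.1 j)) * y b.2 c.2).
Definition on_site (j : 'Z_L) (a : 'M[C]_2) : 'End(hilb) :=
  tensor (fun i => if i == j then a else 1) 1.
Definition on_end (y : endM) : 'End(hilb) := tensor (fun=> 1) y.

(* |s, n> |-> |s \o t, n> *)
Definition site_op (t : 'Z_L -> 'Z_L) : 'End(hilb) :=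
  mxop (fun b c => ([forall j, b.1 j == c.1 (t j)] && (b.2 == c.2))%:R).
Definition transl : 'End(hilb) := site_op (fun j => j - 1).
Definition refl : 'End(hilb) := site_op (fun j => - 1 - j).

Definition charge : 'End(hilb) := tensor (fun=> gmx) (Z ^ (-1)).
Definition sector (m : 'Z_N) : {vspace hilb} :=
  passmx.leigenspace charge (omega ^+ m).

Definition bond (j : 'Z_L) : 'End(hilb) :=
  q *: (on_site j sigp \o on_site (j + 1) sigm)%VF
  + q^-1 *: (on_site j sigm \o on_site (j + 1) sigp)%VF
  + ((q + q^-1) / 4) *: (on_site j sigz \o on_site (j + 1) sigz)%VF.

(* E_(rc) Y_(m,n) on sites A, B and the endpoint; r and c encode two spins,
   |2 s_A + s_B> = |s_A s_B>. *)
Definition EY (A B : 'Z_L) (r c : nat) (m n : int) : 'End(hilb) :=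
  (on_site A (delta_mx (inord r./2) (inord c./2))
   \o on_site B (delta_mx (inord (odd r)) (inord (odd c)))
   \o on_end (Y m n))%VF.

Definition Sbare (s : branch) (A B : 'Z_L) : 'End(hilb) :=
  let E := EY A B in
  match s with
  | Plus =>
    2^-1 *: (- E 0%N 1%N (-1) (-1) + q ^+ 3 *: E 0%N 2%N (-1) 0
             - q ^+ 4 *: E 0%N 3%N (-2) (-1) - q ^+ 2 *: E 1%N 0%N 1 1
             + q ^+ 2 *: E 1%N 2%N 0 1 - q *: E 1%N 3%N (-1) 0
             + q ^- 3 *: E 2%N 0%N 1 0 + q ^- 2 *: E 2%N 1%N 0 (-1)
             + q ^+ 2 *: E 2%N 3%N (-1) (-1) - E 3%N 0%N 2 1
             - q^-1 *: E 3%N 1%N 1 0 + E 3%N 2%N 1 1)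
  | Minus =>
    2^-1 *: (E 0%N 1%N (-1) 1 - q *: E 0%N 2%N (-1) 0
             - E 0%N 3%N (-2) 1 + q ^- 2 *: E 1%N 0%N 1 (-1)
             + q ^+ 2 *: E 1%N 2%N 0 (-1) + q ^+ 3 *: E 1%N 3%N (-1) 0
             - q^-1 *: E 2%N 0%N 1 0 + q ^- 2 *: E 2%N 1%N 0 1
             - q ^- 2 *: E 2%N 3%N (-1) 1 - q ^- 4 *: E 3%N 0%N 2 (-1)
             + q ^- 3 *: E 3%N 1%N 1 0 - E 3%N 2%N 1 (-1))
  end.

Section Output.
Variable eta : 'Z_(2 * N).

Definition seam (s : branch) (A B : 'Z_L) : 'End(hilb) :=
  (on_site B (Fout s eta) \o Sbare s A B \o adj (on_site B (Fout s eta)))%VF.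

Definition ham (s : branch) (k : 'Z_L) : 'End(hilb) :=
  \sum_(j | j != k - 1) bond j + seam s (k - 1) k.

Definition Gplus (j : 'Z_L) : 'End(hilb) :=
  (on_site j (Fout Plus eta)
   \o ((Num.sqrt 2)%:C%C^-1 *:
       \sum_r \sum_s (on_site j (delta_mx r s) \o on_end (Lplus r s))))%VF.
Definition Mplus : 'End(hilb) := (Gplus 0 \o transl)%VF.

Definition C0op : 'End(hilb) :=
  (tensor (fun j => qsz ((2 * L)%:R - delta%:R - (2 * j)%:R))
          (X ^ (- L%:Z - 1) * P)
   \o refl)%VF.
Definition Cop : 'End(hilb) := (tensor (fun=> Fout Plus eta) 1 \o C0op)%VF.

Definition Kop (v : hilb) : hilb := [ffun b => (v b)^*].

(* Antilinear operators are plain maps on vectors. *)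
Definition Theta (v : hilb) : hilb :=
  tensor (fun=> sigx) (X ^+ kappa eta * J) (Kop v).
Definition Aop (v : hilb) : hilb := Cop (Theta v).
Definition Bop (s : branch) (r : int) (v : hilb) : hilb :=
  match s with
  | Plus => lfun_exp Mplus r (Aop v)
  | Minus => adj Cop (lfun_exp Mplus r (Aop (Cop v)))
  end.

Definition csec (s : branch) : 'Z_N :=
  match s with
  | Plus => (2 * L + 1)%:R - kappa eta
  | Minus => - 1 - kappa eta
  end.

End Output.

Definition antiunitary (f : hilb -> hilb) : Prop :=
  [/\ forall (a : C) (u v : hilb), f (a *: u + v) = a^* *: f u + f v,
      bijective f
    & forall u v, inner (f u) (f v) = (inner u v)^*].

End Chain.
End Model.

(* Main.v *)
From HB Require Import structures.
Require Import Defs.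
From mathcomp Require Import all_boot all_order all_algebra.
From mathcomp Require Import complex.
From mathcomp Require Import classical_sets reals trigo.
From mathcomp Require Import zify ring.

Set Implicit Arguments.
Unset Strict Implicit.
Unset Printing Implicit Defensive.

Import Order.TTheory GRing.Theory Num.Theory.
Local Open Scope ring_scope.

(* Every operator in the Hamiltonian is a sum of terms E_(aa') E_(bb') X^m Z^e on
   two sites and the endpoint, where m = a + b - a' - b' by charge conservation.
   Conjugation by C (reflection) or by Theta (spin flip and complex conjugation)
   sends each term to a multiple of another one, and comparing coefficients gives
   C H^- = H^+ C and Theta H^+ = H^- Theta.  With alpha = (q - 1/q)/4, the gate G
   satisfies the local identities
     S_AB G_B = G_B h_AB - alpha sigma^z_B G_B sigma^z_B,
     G_A S_AB = h_AB G_A - alpha sigma^z_A G_A sigma^z_A;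
   the defects cancel when the gate moves the seam from (0, 1) back to (L-1, 0),
   so M = G_0 T commutes with H^+.  Hence B commutes with H, and the action of each
   factor on Q yields m |-> c - m.  Finally, as H is self-adjoint, (u, w) |-> <B u, w>
   is a nondegenerate bilinear pairing of the sectors m and c - m for which H is
   self-adjoint: the matrices of the two restrictions are conjugate up to
   transposition. *)

(** The constants in C and Theta are forced. Reflection exchanges q and 1/q in the hopping part of a
    bond, and the drop by 2 of the exponent 2L - delta - 2j from one site to the next undoes this.
    The quadratic phase P_N turns X^m Z^e into a multiple of X^m Z^(m+e), which is how C exchanges
    the branches. On the seam all dependence on L and delta cancels, so one comparison of
    coefficients serves every N and L. In Theta, the shift X^kappa repairs the powers of f that
    complex conjugation inverts. The gate identities cannot be compared term by term, since products
    of gate and seam mix several terms. They are checked on amplitudes: around a label where Z = x,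
    operators act on functions of two spins and an integer displacement, and what remains is a
    rational identity in q, x, f and finitely many formal amplitudes. The bilinear pairing compares
    characteristic polynomials directly, so multiplicities come without diagonalizing H. *)

Lemma conjCXz (C : numClosedFieldType) (x : C) (k : int) : (x ^ k)^* = x^* ^ k.
Proof. by case: k => n; rewrite ?NegzE -?exprnN ?fmorphV rmorphXn. Qed.

(** * Roots of unity and phases *)

Section Scalars.
Variable R : realType.
Local Notation C := R[i].

Lemma cisD (s t : R) : cis (s + t) = cis s * cis t.
Proof.
by rewrite /cis cosD sinD; simpc; congr (Complex _ _); rewrite addrC [cos s * _]mulrC.
Qed.

Lemma cis0 : cis (0 : R) = 1.
Proof. by rewrite /cis cos0 sin0. Qed.

Lemma cisX (t : R) n : cis t ^+ n = cis (t *+ n).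
Proof. by elim: n => [|n IHn]; rewrite ?expr0 ?mulr0n ?cis0 // exprS mulrS cisD IHn. Qed.

Lemma cisN (t : R) : cis (- t) = (cis t)^-1.
Proof.
apply/esym/(@mulr1_eq C); by rewrite -cisD subrr cis0.
Qed.

Lemma conj_cis (t : R) : (cis t)^* = (cis t)^-1.
Proof. by rewrite -cisN /cis cosN sinN. Qed.

Lemma cis_neq0 (t : R) : cis t != 0.
Proof.
apply/eqP => t0; have: cis t * cis (- t) = 1 by rewrite -cisD subrr cis0.
by rewrite t0 mul0r => /eqP; rewrite eq_sym oner_eq0.
Qed.

Variables N M : nat.
Hypothesis N_ge2 : (2 <= N)%N.
Local Notation eps := (eps R N).
Local Notation q := (q R N M).
Local Notation omega := (omega R N M).

Lemma epsN : eps ^+ N = -1.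
Proof.
rewrite /Defs.eps cisX -[(pi / _) *+ _]mulr_natr divfK ?pnatr_eq0 -?lt0n ?(ltnW N_ge2) //.
by rewrite /cis cospi sinpi; simpc.
Qed.

Lemma eps_neq0 : eps != 0. Proof. exact: cis_neq0. Qed.
Lemma q_neq0 : q != 0. Proof. exact/expf_neq0/eps_neq0. Qed.
Lemma omega_neq0 : omega != 0. Proof. exact/expf_neq0/q_neq0. Qed.

Lemma conj_eps : eps^* = eps^-1. Proof. exact: conj_cis. Qed.
Lemma conj_q : q^* = q^-1. Proof. by rewrite rmorphXn /= conj_eps exprVn. Qed.
Lemma conj_omega : omega^* = omega^-1. Proof. by rewrite rmorphXn /= conj_q exprVn. Qed.

Lemma eps2N : eps ^+ (2 * N) = 1.
Proof. by rewrite mulnC exprM epsN sqrrN expr1n. Qed.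

Lemma omegaN : omega ^+ N = 1.
Proof. by rewrite -!exprM mulnC exprM eps2N expr1n. Qed.

Lemma qN : q ^+ N = (-1) ^+ M.
Proof. by rewrite -exprM mulnC exprM epsN. Qed.

Definition chi (n : 'Z_N) : C := omega ^+ n.

Lemma chiE n : chi n%:R = omega ^+ n.
Proof.
by rewrite /chi val_Zp_nat // [in RHS](divn_eq n N) exprD mulnC exprM omegaN expr1n mul1r.
Qed.

Lemma chi0 : chi 0 = 1. Proof. by []. Qed.

Lemma chiD m n : chi (m + n) = chi m * chi n.
Proof. by rewrite -[m]natr_Zp -[n]natr_Zp -natrD !chiE exprD. Qed.

Lemma chi_neq0 n : chi n != 0. Proof. exact/expf_neq0/omega_neq0. Qed.

Lemma chiN n : chi (- n) = (chi n)^-1.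
Proof. by apply: (mulIf (chi_neq0 n)); rewrite -chiD addNr mulVf ?chi_neq0 // chi0. Qed.

Lemma conj_chi n : (chi n)^* = (chi n)^-1.
Proof. by rewrite rmorphXn /= conj_omega exprVn. Qed.

Lemma conj_chiz n (k : int) : (chi n ^ k)^* = chi n ^ (- k).
Proof. by rewrite conjCXz conj_chi exprz_inv. Qed.

Lemma chiz (k : int) : chi k%:~R = omega ^ k.
Proof.
case: k => n; first exact: chiE.
by rewrite NegzE mulrNz chiN chiE -exprnN.
Qed.

Lemma chi_zq (k : int) : chi k%:~R = q ^ (2 * k).
Proof. by rewrite chiz /Defs.omega [q ^+ 2](_ : _ = q ^ 2) // exprz_exp. Qed.

Section Label.
Hypothesis coMN : coprime M N.
Variable eta : 'Z_(2 * N).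
Local Notation f := (feta R eta).

Lemma feta_neq0 : f != 0. Proof. exact/expf_neq0/eps_neq0. Qed.
Lemma conj_feta : f^* = f^-1. Proof. by rewrite rmorphXn /= conj_eps exprVn. Qed.

Lemma kappaP : M%:R * kappa M eta = - (eta : nat)%:R.
Proof.
rewrite /kappa; case: pickP => [k /eqP //|no].
have uM : (M%:R : 'Z_N) \is a GRing.unit.
  by rewrite unitZpE // coprime_sym.
by have := no ((M%:R)^-1 * - (eta : nat)%:R); rewrite mulVKr ?eqxx.
Qed.

(** The congruence for kappa holds modulo N only, whereas the relation for [eps] is eps^(2N) = 1.
    Squaring f doubles M kappa + eta, a multiple of N, into a multiple of 2N. *)
Lemma chi_kappa : chi (kappa M eta) = f ^- 2.
Proof.
have /eqP : ((M * kappa M eta + eta)%N%:R : 'Z_N) == 0.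
  by rewrite natrD natrM natr_Zp kappaP addNr.
move/(congr1 val); rewrite /= val_Zp_nat // => /eqP /dvdnP[d de].
apply: (mulIf (expf_neq0 2 feta_neq0)).
rewrite mulVf ?expf_neq0 ?eps_neq0 //.
rewrite /chi /Defs.omega /Defs.q /feta -!exprM -exprD.
have -> : (M * (2 * kappa M eta) + eta * 2)%N = (2 * N * d)%N by lia.
by rewrite exprM eps2N expr1n.
Qed.
End Label.

(** The diagonal of [P]. The shift by one puts p_1 at n = 1 and p_N at n = 0. *)
Definition ph (n : 'Z_N) : C := phase R N M (n - 1 : 'Z_N)%R.

Lemma phaseE k : phase R N M k = q ^+ ((1 - delta N) * k + k * k.+1).
Proof.
elim: k => [|k IHk] /=; first by rewrite muln0.
rewrite IHk /omega -exprM -!exprD; congr (_ ^+ _); rewrite !mulnS.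
by rewrite mulSn; lia.
Qed.

(** Cyclic consistency p_(N+1) = p_1: the total exponent is N (N - delta), so the product is (-1)^(M
    (N - delta)), and N - delta is even. *)
Lemma phaseN : q ^+ (1 - delta N) * phase R N M N.-1 = 1.
Proof.
have N0 : (0 < N)%N by exact: ltnW.
rewrite phaseE -exprD prednK // /delta.
have -> : (1 - N %% 2 + ((1 - N %% 2) * N.-1 + N.-1 * N))%N = (N * ((1 - N %% 2) + N.-1))%N.
  by case: (N) N0 => // n _ /=; rewrite mulSn; lia.
rewrite exprM qN modn2 -exprM mulnC exprM.
have : ~~ odd (1 - odd N + N.-1) || ~~ odd M.
  by case: (N) N0 => // n _ /=; rewrite oddD; case: (odd n).
have [oM|eM _] := boolP (odd M); last by rewrite -exprM mulnC exprM -signr_odd (negbTE eM) expr1n.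
by rewrite orbF -(signr_odd _ (_ + _)) => /negbTE ->; rewrite expr1n.
Qed.

Lemma phS (n : 'Z_N) : ph (n + 1) = q ^+ (1 - delta N) * chi n * ph n.
Proof.
(* At n = 0 the step leads from p_N back to p_1, where [phaseN] replaces the recursion. *)
rewrite /ph addrK; have [->|n0] := eqVneq n 0.
  rewrite chi0 mulr1 [0 - 1 : 'Z_N]sub0r.
  have -> : nat_of_ord (- 1 : 'Z_N)%R = N.-1.
    by rewrite /= !Zp_cast // modn_small // ?subn1 // modn_small ?subn1 // prednK // ltnW.
  by rewrite phaseN.
have e : (n : nat) = (n - 1 : 'Z_N)%R.+1.
  have n_gt0 : (0 < n)%N by rewrite lt0n.
  have -> : n - 1 = (n : nat).-1%:R by rewrite -subn1 natrB // natr_Zp.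
  have nN : (n < N)%N by rewrite -[X in (_ < X)%N](Zp_cast N_ge2).
  have -> : nat_of_ord (n.-1%:R : 'Z_N) = n.-1.
    by rewrite val_Zp_nat // modn_small // (leq_ltn_trans (leq_pred _) nN).
  by rewrite prednK.
by rewrite {1}e /= /chi -e.
Qed.

Lemma ph_neq0 n : ph n != 0.
Proof. by rewrite /ph phaseE expf_neq0 ?q_neq0. Qed.

Lemma conj_ph n : (ph n)^* = (ph n)^-1.
Proof. by rewrite /ph phaseE rmorphXn /= conj_q exprVn. Qed.

(** Summing the linear increments of [phS] gives a quadratic exponent. Negative shifts are the
    positive case read backwards. *)
Lemma phD (k : int) (n : 'Z_N) :
  ph (n + k%:~R) = q ^ (k * (k - (delta N)%:Z)) * chi n ^ k * ph n.
Proof.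
have q0 := q_neq0; have c0 := chi_neq0.
have natc (j : nat) (m : 'Z_N) :
    ph (m + j%:R) = q ^ (j%:Z * (j%:Z - (delta N)%:Z)) * chi m ^+ j * ph m.
  elim: j => [|j IHj]; first by rewrite mulr0n addr0 mul0r expr0z expr0 !mul1r.
  rewrite -natr1 addrA phS IHj chiD chiE.
  have -> : q ^+ (1 - delta N) = q ^ (1 - (delta N)%:Z).
    by rewrite [LHS](_ : _ = q ^ (1 - delta N)%N%:Z) // -subzn // /delta modn2 leq_b1.
  have -> : j.+1%:Z * (j.+1%:Z - (delta N)%:Z) =
    1 - (delta N)%:Z + (2 * j)%N%:Z + j%:Z * (j%:Z - (delta N)%:Z) by lia.
  have -> : omega ^+ j = q ^ (2 * j)%N%:Z by rewrite -exprM.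
  by rewrite !(expfzDr _ _ q0) exprS; ring.
case: k => j; first exact: natc.
rewrite NegzE mulrNz; set m := n + _.
have -> : n = m + j.+1%:R by rewrite subrK.
rewrite natc -!exprnN chiD chiE; set J := j.+1.
pose d := (delta N)%:Z.
have eq2 : (omega ^+ J) ^+ J = q ^ (- J%:Z * (- J%:Z - d)) * q ^ (J%:Z * (J%:Z - d)).
  rewrite -(expfzDr _ _ q0) [RHS](_ : _ = q ^ (2 * (J * J))%N%:Z); last by congr (_ ^ _); lia.
  by rewrite -[RHS]/(q ^+ _) !exprM.
rewrite -/d exprMn eq2.
move: (expfz_neq0 (- J%:Z * (- J%:Z - d)) q0) (expfz_neq0 (J%:Z * (J%:Z - d)) q0).
move: (q ^ _) (q ^ _) => a b a0 b0.
by field; rewrite a0 b0 expf_neq0 ?c0.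
Qed.
End Scalars.

(** * Weyl algebra of the endpoint *)

Section Endpoint.
Variables (R : realType) (N M : nat).
Hypothesis N_ge2 : (2 <= N)%N.
Local Notation C := R[i].
Local Notation q := (q R N M).
Local Notation omega := (omega R N M).
Local Notation chi := (@chi R N M).
Local Notation endM := 'M[C]_((Zp_trunc N).+2).
Local Notation X := (X R N).
Local Notation Z := (Z R N M).
Local Notation Y := (Y R N M).

Definition dag n (A : 'M[C]_n) : 'M[C]_n := (map_mx Num.conj A)^T.

Lemma sum_delta (T : finType) (i0 : T) (F : T -> C) :
  \sum_i (i == i0)%:R * F i = F i0.
Proof.
rewrite (bigD1 i0) //= eqxx mul1r big1 ?addr0 // => i /negbTE ->.
by rewrite mul0r.
Qed.

(** A homomorphism from the integers is determined by its value at 1, so integer powers are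
    identified without computing an inverse matrix. *)
Lemma exprz_mx (A : endM) (B : int -> endM) :
  B 0 = 1 -> B 1 = A -> (forall a b, B a * B b = B (a + b)) ->
  forall a, A ^ a = B a.
Proof.
move=> B0 B1 BD.
have nat_pow (n : nat) : A ^+ n = B n.
  by elim: n => [|n IHn]; rewrite ?expr0 // exprS IHn -B1 BD -intS.
case=> n; first exact: nat_pow.
have uB : B n.+1 \is a GRing.unit.
  by apply/unitrP; exists (B (- n.+1%:Z)); rewrite !BD ?subrr ?addNr.
by rewrite NegzE -exprnN nat_pow; apply: (mulrI uB); rewrite divrr // BD subrr.
Qed.

Lemma XzE a : X ^ a = \matrix_(m, n) (m == n + a%:~R :> 'Z_N)%:R.
Proof.
pose B (a : int) : endM := \matrix_(m, n) (m == n + a%:~R :> 'Z_N)%:R.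
rewrite (@exprz_mx _ B) //.
  by apply/matrixP=> m n; rewrite !mxE addr0.
move=> {}a b; apply/matrixP=> m n; rewrite !mxE.
under eq_bigr do rewrite !mxE mulrC.
by rewrite sum_delta rmorphD /= [a%:~R + _]addrC addrA.
Qed.

Lemma ZzE b : Z ^ b = \matrix_(m, n) ((m == n)%:R * chi n ^ b).
Proof.
pose B (b : int) : endM := \matrix_(m, n) ((m == n)%:R * chi n ^ b).
rewrite (@exprz_mx _ B) //.
  by apply/matrixP=> m n; rewrite !mxE expr0z mulr1.
move=> {}b c; apply/matrixP=> m n; rewrite !mxE.
under eq_bigr do rewrite !mxE mulrCA.
by rewrite sum_delta -mulrA expfzDr // chi_neq0.
Qed.

Lemma YE a b m n : Y a b m n = (m == n + a%:~R :> 'Z_N)%:R * chi n ^ b.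
Proof.
rewrite /Defs.Y XzE ZzE !mxE.
under eq_bigr do rewrite !mxE mulrCA.
by rewrite sum_delta.
Qed.

Lemma Y00 : Y 0 0 = 1.
Proof. by rewrite /Defs.Y !expr0z mulr1. Qed.

Lemma YM a b c d : Y a b * Y c d = omega ^ (b * c) *: Y (a + c) (b + d).
Proof.
apply/matrixP=> m n; rewrite [LHS]mxE [RHS]mxE YE.
under eq_bigr do rewrite !YE mulrCA.
rewrite sum_delta chiD // chiz // expfzMl exprz_exp [c * b]mulrC.
rewrite expfzDr ?chi_neq0 // rmorphD /= [a%:~R + _]addrC addrA.
by case: (m == _); rewrite ?mul0r ?mulr0 // !mul1r; ring.
Qed.

Lemma dagY a b : dag (Y a b) = omega ^ (a * b) *: Y (- a) (- b).
Proof.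
apply/matrixP=> m n; rewrite [LHS]mxE [LHS]mxE [RHS]mxE !YE rmorphM /= conjC_nat.
rewrite conj_chiz //.
have [->|mn] := eqVneq n (m + a%:~R).
  rewrite rmorphN /= addrK eqxx !mul1r chiD // chiz // (expfzMl (chi m)) exprz_exp.
  by rewrite mulrCA -expfzDr ?omega_neq0 // mulrN subrr expr0z mulr1.
rewrite (_ : (m == _) = false) ?mul0r ?mulr0 //.
by apply/negbTE; apply: contra mn => /eqP ->; rewrite rmorphN /= subrK.
Qed.

Lemma XPE k m n : (X ^ k * P R N M) m n = (m == n + k%:~R :> 'Z_N)%:R * ph R M n.
Proof.
rewrite XzE mxE; under eq_bigr do rewrite !mxE mulrCA.
by rewrite sum_delta.
Qed.

(** Moving the label by a changes the phase in P by a factor proportional to chi n ^ a, hence the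
    exponent of Z grows by a. The power of X in front contributes a scalar only. *)
Lemma XP_Y k a b :
  X ^ k * P R N M * Y a b =
  (q ^ (a * (a - (delta N)%:Z) - 2 * ((a + b) * k))) *: (Y a (a + b) * (X ^ k * P R N M)).
Proof.
apply/matrixP=> m n; rewrite [in RHS]mxE ![in LHS]mxE [in RHS]mxE.
under eq_bigr do rewrite XPE YE mulrCA.
under [in RHS]eq_bigr do rewrite XPE YE mulrCA.
rewrite !sum_delta.
rewrite phD // chiD // chiz // addrAC.
have -> : omega ^ k = q ^ (2 * k) by rewrite -chi_zq // chiz.
rewrite expfzMl exprz_exp.
case: (m == _); last by rewrite !mul0r mulr0.
rewrite !mul1r (expfzDr _ _ (chi_neq0 R M n)).
have <- : q ^ (a * (a - (delta N)%:Z) - 2 * ((a + b) * k)) * q ^ (2 * k * (a + b)) =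
    q ^ (a * (a - (delta N)%:Z)).
  by rewrite -expfzDr ?q_neq0 //; congr (_ ^ _); ring.
by ring.
Qed.

Lemma XJE (k : 'Z_N) m n : (X ^+ k * J R N) m n = (m == k - n :> 'Z_N)%:R.
Proof.
rewrite [X ^+ k](_ : _ = X ^ (k : nat)%:Z) // XzE mxE.
under eq_bigr do rewrite !mxE mulrC.
by rewrite sum_delta [_%:~R](natr_Zp k) addrC.
Qed.

(** Complex conjugation and J both invert Z, so Z keeps its exponent, while J inverts X. The scalar
    comes from commuting X^k with Z^b. *)
Lemma XJ_Y (k : 'Z_N) a b :
  X ^+ k * J R N * map_mx Num.conj (Y a b) =
  chi k ^ (- b) *: (Y (- a) b * (X ^+ k * J R N)).
Proof.
apply/matrixP=> m n; rewrite [in RHS]mxE ![in LHS]mxE [in RHS]mxE.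
under eq_bigr do rewrite XJE mxE YE rmorphM /= conjC_nat mulrCA.
under [in RHS]eq_bigr do rewrite XJE YE mulrC.
rewrite !sum_delta chiD // chiN // expfzMl exprz_inv.
rewrite opprD addrA rmorphN /= addrAC conj_chiz //.
case: (m == _); rewrite ?mul0r ?mulr0 // !mul1r mulrA -expfzDr ?chi_neq0 //.
by rewrite addNr expr0z mul1r.
Qed.
End Endpoint.

(** * Operators on the chain *)

Section Operators.
Variables (R : realType) (N L : nat).
Local Notation C := R[i].
Local Notation endM := 'M[C]_((Zp_trunc N).+2).
Local Notation config := (config N L).
Local Notation hilb := (hilb R N L).
Implicit Types (u v w : hilb) (A B : 'End(hilb)).

Lemma mxfun_linear (a : config -> config -> C) :
  linear (fun v : hilb => [ffun b => \sum_c a b c * v c] : hilb).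
Proof.
move=> k u v; apply/ffunP=> b; rewrite !ffunE scaler_sumr -big_split.
by apply: eq_bigr => c _; rewrite !ffunE mulrDr; congr (_ + _); exact: mulrCA.
Qed.

Lemma mxopE (a : config -> config -> C) v b :
  mxop a v b = \sum_c a b c * v c.
Proof.
(* [linfun] is known to agree with a function only through a linear structure on it. *)
pose f := GRing.isLinear.Build _ _ _ _ _ (mxfun_linear a).
pose F : {linear hilb -> hilb} :=
  HB.pack (fun v : hilb => [ffun b => \sum_c a b c * v c] : hilb) f.
by rewrite [mxop a v](lfunE F v) ffunE.
Qed.

Lemma mxop_comp (a b : config -> config -> C) :
  (mxop a \o mxop b)%VF = mxop (fun i k => \sum_j a i j * b j k).
Proof.
apply/lfunP=> v; apply/ffunP=> i; rewrite comp_lfunE !mxopE.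
under eq_bigr do rewrite mxopE mulr_sumr.
rewrite exchange_big; apply: eq_bigr => k _.
by rewrite mulr_suml; apply: eq_bigr => j _; rewrite mulrA.
Qed.

Lemma eq_mxop (a b : config -> config -> C) :
  (forall i j, a i j = b i j) -> mxop a = mxop b.
Proof.
move=> ab; apply/lfunP=> v; apply/ffunP=> i; rewrite !mxopE.
by apply: eq_bigr => j _; rewrite ab.
Qed.

Lemma mxop_ket (a : config -> config -> C) b c : mxop a (ket R b) c = a c b.
Proof.
rewrite mxopE; under eq_bigr do rewrite ffunE mulrC.
exact: sum_delta.
Qed.

Lemma sum_ket u : u = \sum_c u c *: ket R c.
Proof.
apply/ffunP=> b; rewrite sum_ffunE; under eq_bigr do rewrite !ffunE eq_sym [_ *: _]mulrC.
by rewrite sum_delta.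
Qed.

Lemma inner_ket b v : inner (ket R b) v = v b.
Proof.
rewrite /inner; under eq_bigr do rewrite ffunE conjC_nat.
exact: sum_delta.
Qed.

Lemma inner_conj u v : (inner u v)^* = inner v u.
Proof.
rewrite rmorph_sum; apply: eq_bigr => b _.
by rewrite rmorphM /= conjCK mulrC.
Qed.

Lemma inner_inj v w : (forall u, inner u v = inner u w) -> v = w.
Proof. by move=> vw; apply/ffunP=> b; rewrite -!inner_ket. Qed.

Lemma innerDr u v w : inner u (v + w) = inner u v + inner u w.
Proof.
by rewrite -big_split; apply: eq_bigr => b _; rewrite ffunE mulrDr.
Qed.

Lemma innerZr a u v : inner u (a *: v) = a * inner u v.
Proof.
by rewrite mulr_sumr; apply: eq_bigr => b _; rewrite ffunE; exact: mulrCA.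
Qed.

Lemma innerDl u v w : inner (u + v) w = inner u w + inner v w.
Proof. by rewrite -inner_conj innerDr rmorphD /= !inner_conj. Qed.

Lemma innerZl a u v : inner (a *: u) v = a^* * inner u v.
Proof. by rewrite -inner_conj innerZr rmorphM /= inner_conj. Qed.

Lemma adjopP A u v : inner (A u) v = inner u (adj A v).
Proof.
rewrite {1}/inner /inner [in LHS](sum_ket u).
under eq_bigr do rewrite linear_sum sum_ffunE rmorph_sum mulr_suml.
rewrite exchange_big; apply: eq_bigr => c _; rewrite mxopE mulr_sumr.
by apply: eq_bigr => b _; rewrite linearZ ffunE rmorphM mulrA.
Qed.

Lemma adj_unique A B :
  (forall u v, inner (A u) v = inner u (B v)) -> adj A = B.
Proof.
by move=> AB; apply/lfunP=> v; apply: inner_inj => u; rewrite -adjopP.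
Qed.

Lemma adjopK A : adj (adj A) = A.
Proof.
by apply: adj_unique => u v; rewrite -inner_conj -adjopP inner_conj.
Qed.

Lemma adj_comp A B : adj (A \o B) = (adj B \o adj A)%VF.
Proof. by apply: adj_unique => u v; rewrite !comp_lfunE !adjopP. Qed.

Lemma adjopD A B : adj (A + B) = adj A + adj B.
Proof.
by apply: adj_unique => u v; rewrite !add_lfunE innerDl innerDr !adjopP.
Qed.

Lemma adjopZ a A : adj (a *: A) = a^* *: adj A.
Proof.
by apply: adj_unique => u v; rewrite !scale_lfunE innerZl innerZr !adjopP.
Qed.

Lemma adjop0 : adj (0 : 'End(hilb)) = 0.
Proof. by rewrite -[0](scale0r (0 : 'End(hilb))) adjopZ conjC0 !scale0r. Qed.

Lemma adj_sum (I : finType) (p : pred I) (F : I -> 'End(hilb)) :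
  adj (\sum_(i | p i) F i) = \sum_(i | p i) adj (F i).
Proof. exact: (big_morph _ adjopD adjop0). Qed.

Lemma adj_mxop (a : config -> config -> C) :
  adj (mxop a) = mxop (fun b c => (a c b)^*).
Proof. by apply: eq_mxop => b c; rewrite mxop_ket. Qed.

Definition unitary A := (adj A \o A)%VF == \1%VF.

Lemma unitaryP A : reflect (forall u v, inner (A u) (A v) = inner u v) (unitary A).
Proof.
apply: (iffP eqP) => [uA u v|iA]; first by rewrite adjopP -comp_lfunE uA id_lfunE.
by apply/lfunP=> v; apply: inner_inj => u; rewrite comp_lfunE -adjopP iA id_lfunE.
Qed.

Lemma unitaryK A : unitary A -> cancel A (adj A).
Proof. by move=> /eqP uA v; rewrite -comp_lfunE uA id_lfunE. Qed.

Lemma unitary_lker A : unitary A -> lker A == 0%VS.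
Proof. by move=> uA; apply/lker0P/(can_inj (unitaryK uA)). Qed.

(** In finite dimension injectivity makes [(A^-1)%VF] a right inverse of A, so the left inverse
    [adj A] is one too. *)
Lemma unitaryKV A : unitary A -> cancel (adj A) A.
Proof.
move=> uA v; rewrite -{1}(lker0_lfunVK (unitary_lker uA) v) unitaryK //.
exact: lker0_lfunVK (unitary_lker uA) v.
Qed.

Lemma unitary_inv A : unitary A -> (A^-1)%VF = adj A.
Proof.
move=> uA; apply/lfunP=> v; apply: (can_inj (unitaryK (A := A) uA)).
by rewrite (lker0_lfunVK (unitary_lker uA)) unitaryKV.
Qed.

Lemma unitary_adj A : unitary A -> unitary (adj A).
Proof.
move=> uA; apply/eqP/lfunP=> v.
by rewrite adjopK comp_lfunE id_lfunE unitaryKV.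
Qed.

Lemma unitary_comp A B : unitary A -> unitary B -> unitary (A \o B).
Proof.
move=> /unitaryP uA /unitaryP uB; apply/unitaryP => u v.
by rewrite !comp_lfunE uA uB.
Qed.

Lemma unitary_exp A r : unitary A -> unitary (lfun_exp A r).
Proof.
have u1 : unitary \1%VF by apply/unitaryP => u v; rewrite !id_lfunE.
move=> uA; case: r => n; rewrite /lfun_exp.
  by elim: n => //= n IHn; apply: unitary_comp.
elim: n.+1 => [//|k IHk]; rewrite iterS; apply: unitary_comp => //.
by rewrite unitary_inv ?unitary_adj.
Qed.

Lemma commute_exp A B r : unitary A ->
  (A \o B = B \o A -> lfun_exp A r \o B = B \o lfun_exp A r)%VF.
Proof.
have c1 : (\1 \o B = B \o \1)%VF by rewrite comp_lfun1l comp_lfun1r.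
move=> uA cAB.
have step D n : (D \o B = B \o D)%VF ->
    (iter n (fun g => D \o g) \1 \o B = B \o iter n (fun g => D \o g) \1)%VF.
  by move=> cD; elim: n => //= k IHk; rewrite -comp_lfunA IHk !comp_lfunA cD.
case: r => n; first exact: step.
apply: step; rewrite unitary_inv //; apply/lfunP => v.
apply: (can_inj (unitaryK uA)); rewrite !comp_lfunE unitaryKV //.
by rewrite -[RHS]comp_lfunE cAB comp_lfunE unitaryKV.
Qed.

Lemma tensor_comp a b (y z : endM) :
  (tensor (L := L) a y \o tensor b z)%VF = tensor (fun j => a j * b j) (y * z).
Proof.
rewrite mxop_comp; apply: eq_mxop => s t.
have -> : \prod_j (a j * b j) (s.1 j) (t.1 j) =
    \sum_(c : {ffun 'Z_L -> 'I_2}) \prod_j (a j (s.1 j) (c j) * b j (c j) (t.1 j)).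
  rewrite -(bigA_distr_bigA (fun j r => a j (s.1 j) r * b j r (t.1 j))).
  by apply: eq_bigr => j _; rewrite mxE.
rewrite mxE big_distrlr pair_big /=; apply: eq_bigr => p _.
by rewrite big_split /= mulrACA.
Qed.

Lemma eq_tensor a b (y : endM) : a =1 b -> tensor (L := L) a y = tensor b y.
Proof.
move=> ab; apply: eq_mxop => s t; congr (_ * _).
by apply: eq_bigr => j _; rewrite ab.
Qed.

Lemma adj_tensor a (y : endM) :
  adj (tensor (L := L) a y) = tensor (fun j => dag (a j)) (dag y).
Proof.
rewrite adj_mxop; apply: eq_mxop => s t.
rewrite rmorphM rmorph_prod !mxE; congr (_ * _).
by apply: eq_bigr => j _; rewrite !mxE.
Qed.

Lemma tensor1 : tensor (L := L) (fun=> 1) (1 : endM) = \1%VF.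
Proof.
apply/lfunP=> v; apply/ffunP=> b; rewrite mxopE id_lfunE.
rewrite -[RHS](sum_delta b v); apply: eq_bigr => c _; congr (_ * _).
have [->|cb] := eqVneq c b.
  by rewrite mxE eqxx mulr1 big1 // => j _; rewrite mxE eqxx.
have [e2|n2] := eqVneq b.2 c.2; last by rewrite [X in _ * X]mxE (negbTE n2) mulr0.
have [j nj] : exists j, b.1 j != c.1 j.
  apply/existsP; rewrite -[X in is_true X]negbK negb_exists; apply/negP => /forallP e1.
  case/eqP: cb; rewrite (surjective_pairing c) (surjective_pairing b) -e2; congr (_, _).
  by apply/ffunP=> j; apply/eqP; rewrite eq_sym -[_ == _]negbK e1.
by rewrite (bigD1 j) //= mxE (negbTE nj) !mul0r.
Qed.

Lemma tensor_unitary a (y : endM) :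
  (forall j, dag (a j) * a j = 1) -> dag y * y = 1 ->
  unitary (tensor (L := L) a y).
Proof.
move=> ua uy; apply/eqP; rewrite adj_tensor tensor_comp uy -tensor1.
exact: eq_tensor.
Qed.

Section SitePermutation.
Variables t t' : 'Z_L -> 'Z_L.
Hypotheses (tK : cancel t t') (tK' : cancel t' t).

Lemma site_opE v (b : config) : site_op R N t v b = v ([ffun j => b.1 (t' j)], b.2).
Proof.
rewrite mxopE -[RHS]sum_delta; apply: eq_bigr => -[c n] _; congr (_%:R * _).
apply: congr1; rewrite /= xpair_eqE [n == _]eq_sym; congr (_ && _).
apply/forallP/eqP => [e|-> j]; last by rewrite ffunE tK.
by apply/ffunP=> j; rewrite ffunE (eqP (e _)) tK'.
Qed.

Lemma site_op_tensor a (y : endM) :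
  (site_op R N t \o tensor a y)%VF = (tensor (fun j => a (t j)) y \o site_op R N t)%VF.
Proof.
apply/lfunP=> v; apply/ffunP=> b; rewrite !comp_lfunE site_opE !mxopE.
pose h (c : config) : config := ([ffun j => c.1 (t j)], c.2).
rewrite [RHS](reindex h) /=; last first.
  exists (fun c : config => ([ffun j => c.1 (t' j)], c.2)) => -[c n] _; congr (_, _).
    by apply/ffunP=> j; rewrite !ffunE tK'.
  by apply/ffunP=> j; rewrite !ffunE tK.
apply: eq_bigr => -[c n] _; rewrite site_opE /=; congr (_ * _ * _).
  rewrite [LHS](reindex t) /=; last by exists t' => j _.
  by apply: eq_bigr => j _; rewrite !ffunE tK.
by congr (v (_, _)); apply/ffunP=> j; rewrite !ffunE tK'.
Qed.

Lemma site_op_unitary : unitary (site_op R N t).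
Proof.
apply/unitaryP => u v; rewrite /inner.
pose h (c : config) : config := ([ffun j => c.1 (t j)], c.2).
rewrite (reindex h) /=; last first.
  exists (fun c : config => ([ffun j => c.1 (t' j)], c.2)) => -[c n] _; congr (_, _).
    by apply/ffunP=> j; rewrite !ffunE tK'.
  by apply/ffunP=> j; rewrite !ffunE tK.
apply: eq_bigr => -[c n] _; rewrite !site_opE /=.
have -> : [ffun j => [ffun j0 => c (t j0)] (t' j)] = c.
  by apply/ffunP=> j; rewrite !ffunE tK'.
by [].
Qed.
End SitePermutation.

Definition upd (s : {ffun 'Z_L -> 'I_2}) j r : {ffun 'Z_L -> 'I_2} :=
  [ffun i => if i == j then r else s i].

Lemma on_siteE (j : 'Z_L) (a : 'M[C]_2) v (s : {ffun 'Z_L -> 'I_2}) (n : 'Z_N) :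
  on_site N j a v (s, n) = \sum_r a (s j) r * v (upd s j r, n).
Proof.
(* Only columns that agree with (s, n) away from site j contribute; for any other column some
   identity factor vanishes. *)
rewrite mxopE (bigID (fun c : config => c == (upd s j (c.1 j), n))) /=.
rewrite [X in _ + X]big1 ?addr0 => [|[c m]].
  rewrite (reindex_onto (fun r => (upd s j r, n)) (fun c => c.1 j)) /=; last first.
    by move=> c /eqP <-.
  apply: eq_big => [r|r _]; first by rewrite !ffunE eqxx !eqxx.
  rewrite mxE eqxx mulr1 (bigD1 j) //= eqxx !ffunE eqxx big1 ?mulr1 // => i ij.
  by rewrite (negbTE ij) ffunE (negbTE ij) mxE eqxx.
rewrite /= xpair_eqE negb_and => /orP[cs|mn]; last first.
  by rewrite [X in _ * X * _]mxE eq_sym (negbTE mn) mulr0 mul0r.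
have [i /andP[ij ni]] : exists i, (i != j) && (s i != c i).
  apply/existsP; rewrite -[X in is_true X]negbK negb_exists; apply/negP => /forallP e1.
  case/eqP: cs; apply/ffunP=> i; rewrite ffunE; case: (eqVneq i j) => [->//|ij].
  by have := e1 i; rewrite ij /= negbK => /eqP.
by rewrite (bigD1 i) //= (negbTE ij) mxE (negbTE ni) !mul0r.
Qed.

Lemma on_endE (y : endM) v (s : {ffun 'Z_L -> 'I_2}) (n : 'Z_N) :
  on_end L y v (s, n) = \sum_m y n m * v (s, m).
Proof.
rewrite mxopE (bigID (fun c : config => c == (s, c.2))) /=.
rewrite [X in _ + X]big1 ?addr0 => [|[c m]].
  rewrite (reindex_onto (fun m => (s, m)) (fun c => c.2)) /=; last first.
    by move=> c /eqP <-.
  apply: eq_big => [m|m _]; first by rewrite !eqxx.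
  by rewrite big1 ?mul1r // => i _; rewrite mxE eqxx.
rewrite /= xpair_eqE eqxx andbT => cs.
have [i ni] : exists i, s i != c i.
  apply/existsP; rewrite -[X in is_true X]negbK negb_exists; apply/negP => /forallP e1.
  case/eqP: cs; apply/ffunP=> i.
  by have := e1 i; rewrite negbK => /eqP.
by rewrite (bigD1 i) //= mxE (negbTE ni) !mul0r.
Qed.
End Operators.

(** * Intertwining relations for semilinear maps *)

Section Intertwining.
Variables (F : fieldType) (V : vectType F).
Implicit Types (T : V -> V) (A B : 'End(V)).

(** The twist phi is the identity for C, the translation, the gate and the charge, and complex
    conjugation for Theta, so one set of rules serves all of them. *)
Definition semilin (phi : F -> F) T :=
  forall a u v, T (a *: u + v) = phi a *: T u + T v.
Definition itw T A B := forall v, T (A v) = B (T v).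

Lemma semilin_lfun A : semilin id A.
Proof. by move=> a u v; rewrite linearP. Qed.

Variables (phi : F -> F) (T : V -> V).
Hypothesis Tlin : semilin phi T.
Hypothesis phi0 : phi 1 = 1.

Lemma semilin0 : T 0 = 0.
Proof. by apply: (addIr (T 0)); have := Tlin 1 0 0; rewrite phi0 !scale1r addr0 add0r => <-. Qed.

Lemma itwD A B A' B' : itw T A B -> itw T A' B' -> itw T (A + A') (B + B').
Proof.
move=> h h' v; rewrite !add_lfunE -h -h'.
by rewrite -[A v]scale1r Tlin phi0 !scale1r.
Qed.

Lemma itwZ a A B : itw T A B -> itw T (a *: A) (phi a *: B).
Proof. by move=> h v; rewrite !scale_lfunE -h -[_ *: A v]addr0 Tlin semilin0 addr0. Qed.

Lemma itw0 : itw T 0 0.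
Proof. by move=> v; rewrite !lfunE /= semilin0. Qed.

Lemma itw_sum (I : Type) (r : seq I) (p : pred I) (G H : I -> 'End(V)) :
  (forall i, p i -> itw T (G i) (H i)) ->
  itw T (\sum_(i <- r | p i) G i) (\sum_(i <- r | p i) H i).
Proof. by move=> h; apply: big_ind2 => // [|*]; [exact: itw0|exact: itwD]. Qed.

Lemma itw_comp A B A' B' : itw T A B -> itw T A' B' -> itw T (A \o A') (B \o B').
Proof. by move=> h h' v; rewrite !comp_lfunE h h'. Qed.
End Intertwining.

Lemma itw_lfun (F : fieldType) (V : vectType F) (T A B : 'End(V)) :
  itw T A B <-> (T \o A = B \o T)%VF.
Proof.
split=> [h|h v]; first by apply/lfunP=> v; rewrite !comp_lfunE.
by rewrite -!comp_lfunE h.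
Qed.

Lemma ord2_ind (K : 'I_2 -> Prop) : K 0 -> K 1 -> forall a, K a.
Proof.
move=> K0 K1 [[|[|//]] ha]; [move: K0|move: K1]; congr K; exact: val_inj.
Qed.

(** * Coefficients of two-site operators *)

Section FourFoldSum.
Variable V : nmodType.
Implicit Types F G : 'I_2 -> 'I_2 -> 'I_2 -> 'I_2 -> V.

(** The indices are the two row spins followed by the two column spins of a two-site matrix
    element. *)
Definition sum4 F : V := \sum_a \sum_b \sum_a' \sum_b' F a b a' b'.

Lemma eq_sum4 F G : (forall a b a' b', F a b a' b' = G a b a' b') -> sum4 F = sum4 G.
Proof. by move=> FG; do 4 (apply: eq_bigr => ? _). Qed.

Lemma sum4_swap F : sum4 F = sum4 (fun b a b' a' => F a b a' b').
Proof.
rewrite /sum4 exchange_big; apply: eq_bigr => b _; apply: eq_bigr => a _.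
exact: exchange_big.
Qed.

Lemma sum4_transpose F : sum4 F = sum4 (fun a' b' a b => F a b a' b').
Proof.
rewrite /sum4; under eq_bigr do rewrite exchange_big.
rewrite exchange_big; apply: eq_bigr => a' _.
under eq_bigr do rewrite exchange_big.
exact: exchange_big.
Qed.

Lemma sum4_flip F : sum4 F =
  sum4 (fun a b a' b' => F (rev_ord a) (rev_ord b) (rev_ord a') (rev_ord b')).
Proof.
have rb : {on predT, bijective (@rev_ord 2)}.
  by exists (@rev_ord 2) => ? _; rewrite rev_ordK.
rewrite /sum4 (reindex _ rb); apply: eq_bigr => a _.
rewrite (reindex _ rb); apply: eq_bigr => b _.
by rewrite (reindex _ rb); apply: eq_bigr => a' _; rewrite (reindex _ rb).
Qed.

Lemma sum4E F : sum4 F =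
    F 0 0 0 0 + F 0 0 0 1 + F 0 0 1 0 + F 0 0 1 1
  + F 0 1 0 0 + F 0 1 0 1 + F 0 1 1 0 + F 0 1 1 1
  + F 1 0 0 0 + F 1 0 0 1 + F 1 0 1 0 + F 1 0 1 1
  + F 1 1 0 0 + F 1 1 0 1 + F 1 1 1 0 + F 1 1 1 1.
Proof.
have S2 (G : 'I_2 -> V) : \sum_i G i = G 0 + G 1.
  by rewrite big_ord_recl big_ord_recl big_ord0 addr0; congr (_ + G _); apply: val_inj.
by rewrite /sum4 !S2 !addrA.
Qed.
End FourFoldSum.

Lemma sum4_ind2 (V W : nmodType) (K : V -> W -> Prop) F G :
  K 0 0 -> (forall x y x' y', K x x' -> K y y' -> K (x + y) (x' + y')) ->
  (forall a b a' b', K (F a b a' b') (G a b a' b')) ->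
  K (sum4 F) (sum4 G).
Proof.
move=> K0 KD KF.
have KS (f : 'I_2 -> V) (g : 'I_2 -> W) :
    (forall i, K (f i) (g i)) -> K (\sum_i f i) (\sum_i g i).
  by move=> Kfg; apply: big_ind2 => // *; apply: KD.
by do 4 (apply: (KS) => ?).
Qed.

(* Every X-power occurring in the Hamiltonian compensates the change of the
   number of up spins, as required by charge conservation. *)
Definition flux (a b a' b' : 'I_2) : int := a%:Z + b%:Z - a'%:Z - b'%:Z.

(** The same integer is the exponent of Z in a seam term and the exponent of f that conjugation by F
    on the second site produces. *)
Definition sexp (s : branch) (a b a' b' : 'I_2) : int :=
  match s with Plus => b%:Z - b'%:Z | Minus => b'%:Z - b%:Z end.

Definition diagc (T : Type) (x y : T) (a : 'I_2) : T := if a == 0 then x else y.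

Section Coefficients.
Variables (F : fieldType) (q : F).

Definition bcoef (a b a' b' : 'I_2) : F :=
  match (a : nat), (b : nat), (a' : nat), (b' : nat) with
  | 0%N, 0%N, 0%N, 0%N | 1%N, 1%N, 1%N, 1%N => (q + q^-1) / 4
  | 0%N, 1%N, 0%N, 1%N | 1%N, 0%N, 1%N, 0%N => - ((q + q^-1) / 4)
  | 0%N, 1%N, 1%N, 0%N => q
  | 1%N, 0%N, 0%N, 1%N => q^-1
  | _, _, _, _ => 0
  end.

Definition scoef (s : branch) (a b a' b' : 'I_2) : F :=
  match s, (2 * a + b)%N, (2 * a' + b')%N with
  | Plus, 0%N, 1%N => - 1
  | Plus, 0%N, 2%N => q ^+ 3
  | Plus, 0%N, 3%N => - q ^+ 4
  | Plus, 1%N, 0%N => - q ^+ 2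
  | Plus, 1%N, 2%N => q ^+ 2
  | Plus, 1%N, 3%N => - q
  | Plus, 2%N, 0%N => q ^- 3
  | Plus, 2%N, 1%N => q ^- 2
  | Plus, 2%N, 3%N => q ^+ 2
  | Plus, 3%N, 0%N => - 1
  | Plus, 3%N, 1%N => - q^-1
  | Plus, 3%N, 2%N => 1
  | Minus, 0%N, 1%N => 1
  | Minus, 0%N, 2%N => - q
  | Minus, 0%N, 3%N => - 1
  | Minus, 1%N, 0%N => q ^- 2
  | Minus, 1%N, 2%N => q ^+ 2
  | Minus, 1%N, 3%N => q ^+ 3
  | Minus, 2%N, 0%N => - q^-1
  | Minus, 2%N, 1%N => q ^- 2
  | Minus, 2%N, 3%N => - q ^- 2
  | Minus, 3%N, 0%N => - q ^- 4
  | Minus, 3%N, 1%N => q ^- 3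
  | Minus, 3%N, 2%N => - 1
  | _, _, _ => 0
  end.

Definition kseam (f : F) s a b a' b' : F :=
  2^-1 * scoef s a b a' b' * f ^ sexp s a b a' b'.

Lemma bcoef_flux a b a' b' : bcoef a b a' b' != 0 -> flux a b a' b' = 0.
Proof.
by move: a b a' b'; do 4 (apply: ord2_ind); rewrite /bcoef /= ?eqxx.
Qed.

Variables (V : lmodType F) (P : 'I_2 -> 'I_2 -> 'I_2 -> 'I_2 -> V).

Lemma sum4_bcoef :
  sum4 (fun a b a' b' => bcoef a b a' b' *: P a b a' b') =
  q *: P 0 1 1 0 + q^-1 *: P 1 0 0 1
  + ((q + q^-1) / 4) *: (P 0 0 0 0 - P 0 1 0 1 - P 1 0 1 0 + P 1 1 1 1).
Proof.
rewrite sum4E /bcoef /= !scale0r ?add0r !addr0 !scaleNr !scalerDr !scalerN !addrA.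
by congr (_ - _ + _); rewrite -addrA addrC addrA.
Qed.

Lemma sum4_scoef_plus :
  sum4 (fun a b a' b' => (2^-1 * scoef Plus a b a' b') *: P a b a' b') =
  2^-1 *: (- P 0 0 0 1 + q ^+ 3 *: P 0 0 1 0 - q ^+ 4 *: P 0 0 1 1
    - q ^+ 2 *: P 0 1 0 0 + q ^+ 2 *: P 0 1 1 0 - q *: P 0 1 1 1
    + q ^- 3 *: P 1 0 0 0 + q ^- 2 *: P 1 0 0 1 + q ^+ 2 *: P 1 0 1 1
    - P 1 1 0 0 - q^-1 *: P 1 1 0 1 + P 1 1 1 0).
Proof.
rewrite sum4E /scoef /= !mulr0 !scale0r !add0r !addr0 !mulrN !mulr1 !scaleNr.
by rewrite !scalerDr !scalerN !scalerA ?addrA.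
Qed.

Lemma sum4_scoef_minus :
  sum4 (fun a b a' b' => (2^-1 * scoef Minus a b a' b') *: P a b a' b') =
  2^-1 *: (P 0 0 0 1 - q *: P 0 0 1 0 - P 0 0 1 1 + q ^- 2 *: P 0 1 0 0
    + q ^+ 2 *: P 0 1 1 0 + q ^+ 3 *: P 0 1 1 1 - q^-1 *: P 1 0 0 0
    + q ^- 2 *: P 1 0 0 1 - q ^- 2 *: P 1 0 1 1 - q ^- 4 *: P 1 1 0 0
    + q ^- 3 *: P 1 1 0 1 - P 1 1 1 0).
Proof.
rewrite sum4E /scoef /= !mulr0 !scale0r !add0r !addr0 !mulrN !mulr1 !scaleNr.
by rewrite !scalerDr !scalerN !scalerA ?addrA.
Qed.
End Coefficients.

(* Turns the integer powers with a closed exponent into natural powers, which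
   the field tactic understands. *)
Ltac eval_powers :=
  repeat match goal with
  | |- context [@exprz ?F ?x ?k] =>
    let k' := eval vm_compute in k in
    match k' with
    | Posz ?n => change (@exprz F x k) with (x ^+ n)
    | Negz ?n => change (@exprz F x k) with (x ^- n.+1)
    end
  end.

Section CoefficientSymmetries.
Variables (F : fieldType) (q : F).
Hypothesis q0 : q != 0.
Implicit Types a b : 'I_2.

Ltac spin_cases :=
  do 4 (apply: ord2_ind); rewrite /bcoef /scoef /flux /sexp /=; eval_powers;
  rewrite ?mul0r ?exprVn ?invrK //; first [by ring | by field].

Lemma bcoef_reflect : forall a b a' b',
  bcoef q a b a' b' * q ^ (2 * (a%:Z - a'%:Z)) = bcoef q b a b' a'.
Proof. spin_cases. Qed.

(** The exponent is what conjugation by C leaves on a seam term: the square comes from P_N, the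
    linear terms from the physical factors and X^(-L-1) after L and delta have cancelled. The spins
    are exchanged on the right because reflection exchanges the two seam sites. *)
Lemma scoef_reflect : forall a b a' b',
  scoef q Minus a b a' b' *
    q ^ (flux a b a' b' * flux a b a' b' + 2 * (b'%:Z - b%:Z) + 2 * (a%:Z - a'%:Z)) =
  scoef q Plus b a b' a'.
Proof. spin_cases. Qed.

Lemma bcoef_flip : forall a b a' b',
  bcoef q^-1 (rev_ord a) (rev_ord b) (rev_ord a') (rev_ord b') = bcoef q a b a' b'.
Proof. spin_cases. Qed.

Lemma scoef_flip : forall a b a' b',
  scoef q^-1 Plus (rev_ord a) (rev_ord b) (rev_ord a') (rev_ord b') =
  scoef q Minus a b a' b'.
Proof. spin_cases. Qed.

Lemma bcoef_adj : forall a b a' b', bcoef q^-1 a' b' a b = bcoef q a b a' b'.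
Proof. spin_cases. Qed.

(** The power of q comes from restoring the order of X and Z after taking the adjoint. *)
Lemma scoef_adj s : forall a b a' b',
  scoef q^-1 s a' b' a b * q ^ (2 * (flux a' b' a b * sexp s a' b' a b)) =
  scoef q s a b a' b'.
Proof. case: s; spin_cases. Qed.
End CoefficientSymmetries.

Lemma map_bcoef (F G : fieldType) (phi : {rmorphism F -> G}) (q : F) a b a' b' :
  phi (bcoef q a b a' b') = bcoef (phi q) a b a' b'.
Proof.
move: a b a' b'; do 4 (apply: ord2_ind); rewrite /bcoef /= ?rmorph0 //.
all: by rewrite ?rmorphN ?rmorphM ?rmorphD ?fmorphV ?rmorph_nat.
Qed.

Lemma map_scoef (F G : fieldType) (phi : {rmorphism F -> G}) (q : F) s a b a' b' :
  phi (scoef q s a b a' b') = scoef (phi q) s a b a' b'.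
Proof.
move: a b a' b'; case: s; do 4 (apply: ord2_ind); rewrite /scoef /= ?rmorph0 //.
all: by rewrite ?rmorphN ?fmorphV ?rmorphXn ?rmorph1.
Qed.

Lemma flux_flip a b a' b' :
  flux (rev_ord a) (rev_ord b) (rev_ord a') (rev_ord b') = - flux a b a' b'.
Proof. by move: a b a' b'; do 4 (apply: ord2_ind). Qed.

Lemma sexp_flip a b a' b' :
  sexp Plus (rev_ord a) (rev_ord b) (rev_ord a') (rev_ord b') = sexp Minus a b a' b'.
Proof. by move: a b a' b'; do 4 (apply: ord2_ind). Qed.

Lemma sum2_delta (C : fieldType) (F : 'I_2 -> 'I_2 -> 'I_2 -> 'I_2 -> C) a b :
  sum4 (fun c d c' d' => (a == c)%:R * ((b == d)%:R * F c d c' d')) =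
  F a b 0 0 + F a b 0 1 + F a b 1 0 + F a b 1 1.
Proof.
rewrite sum4E; move: a b; do 2 (apply: ord2_ind);
  by rewrite /= !(mul0r, mulr0, mul1r, add0r, addr0).
Qed.

(** Displacements are brought to normal form so that equal amplitudes become one atom for
    [field]. *)
Ltac eval_index W :=
  repeat match goal with
  | |- context [W ?a ?b ?k] =>
    let k' := eval vm_compute in k in progress change (W a b k) with (W a b k')
  end.

(** * Gate identities on formal amplitudes *)

Section GateFunctionals.
Variables (F : numFieldType) (q x f g : F).
Implicit Types (W : 'I_2 -> 'I_2 -> int -> F) (a b c d : 'I_2) (z : int).

(** Scalar parts of the blocks of L_+; the monomial left in block (a, b) is X^(a-b) Z^a. *)
Definition lcoef a b : F :=
  if a == 0 then (if b == 0 then 1 else q ^+ 2) else (if b == 0 then - q else q).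

(* op2f, gateB and gateA describe the action of a two-site operator and of the gate
   on the second or first site on amplitudes W a b z, where a and b are the two
   spins and z is the displacement of the endpoint from a label at which Z = x. *)
Definition op2f k (e : 'I_2 -> 'I_2 -> 'I_2 -> 'I_2 -> int) W a b z : F :=
  let t c d := let m := flux a b c d in let l := e a b c d in
    k a b c d * (x ^ l * q ^ (2 * (l * (z - m))) * W c d (z - m)) in
  t 0 0 + t 0 1 + t 1 0 + t 1 1.

Definition gateB W a b z : F :=
  let t d := let m := b%:Z - d%:Z in
    lcoef b d * (x ^ b * q ^ (2 * (b%:Z * (z - m))) * W a d (z - m)) in
  g * (if b == 0 then 1 else f) * (t 0 + t 1).

Definition gateA W a b z : F :=
  let t c := let m := a%:Z - c%:Z in
    lcoef a c * (x ^ a * q ^ (2 * (a%:Z * (z - m))) * W c b (z - m)) in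
  g * (if a == 0 then 1 else f) * (t 0 + t 1).

Hypotheses (q0 : q != 0) (x0 : x != 0) (f0 : f != 0).

(** W is an arbitrary function of the displacement, so each of the four spin cases is a rational
    identity with independent amplitudes. Displacement 0 is enough because x stands for the value of
    Z at any label. The last term is the defect. *)
Lemma gateB_seam W : forall a b,
  op2f (kseam q f Plus) (sexp Plus) (gateB W) a b 0 =
  gateB (op2f (bcoef q) (fun _ _ _ _ => 0) W) a b 0
  - (q - q^-1) / 4 * (diagc 1 (-1) b * gateB (fun c d z => diagc 1 (-1) d * W c d z) a b 0).
Proof.
do 2 (apply: ord2_ind); rewrite /op2f /gateB /kseam /lcoef /bcoef /scoef /sexp /flux /diagc /=.
all: eval_powers; eval_index W.
all: by field; rewrite ?q0 ?x0 ?f0.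
Qed.

Lemma gateA_seam W : forall a b,
  gateA (op2f (kseam q f Plus) (sexp Plus) W) a b 0 =
  op2f (bcoef q) (fun _ _ _ _ => 0) (gateA W) a b 0
  - (q - q^-1) / 4 * (diagc 1 (-1) a * gateA (fun c d z => diagc 1 (-1) c * W c d z) a b 0).
Proof.
do 2 (apply: ord2_ind); rewrite /op2f /gateA /kseam /lcoef /bcoef /scoef /sexp /flux /diagc /=.
all: eval_powers; eval_index W.
all: by field; rewrite ?q0 ?x0 ?f0.
Qed.

Lemma eq_op2f k e W W' : (forall a b z, W a b z = W' a b z) ->
  forall a b z, op2f k e W a b z = op2f k e W' a b z.
Proof. by move=> WW a b z; rewrite /op2f !WW. Qed.

Lemma eq_gateA W W' : (forall a b z, W a b z = W' a b z) ->
  forall a b z, gateA W a b z = gateA W' a b z.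
Proof. by move=> WW a b z; rewrite /gateA !WW. Qed.

Lemma eq_gateB W W' : (forall a b z, W a b z = W' a b z) ->
  forall a b z, gateB W a b z = gateB W' a b z.
Proof. by move=> WW a b z; rewrite /gateB !WW. Qed.
End GateFunctionals.

Section SumsButOne.
Variables (I : finType) (V : zmodType) (F : I -> V) (i0 i1 : I).
Hypothesis i01 : i0 != i1.

Lemma sum_but_left :
  \sum_(j | j != i0) F j = F i1 + \sum_(j | (j != i0) && (j != i1)) F j.
Proof. by rewrite (bigD1 i1) // eq_sym. Qed.

Lemma sum_but_right :
  \sum_(j | j != i1) F j = F i0 + \sum_(j | (j != i0) && (j != i1)) F j.
Proof.
rewrite (bigD1 i0) //=; congr (_ + _).
by apply: eq_bigl => j; rewrite andbC.
Qed.
End SumsButOne.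

(** * Paired invariant subspaces *)

Section CharPoly.
Variable F : fieldType.

Lemma char_poly_tr n (A : 'M[F]_n) : char_poly A^T = char_poly A.
Proof.
rewrite /char_poly -[RHS]det_tr; congr (\det _).
by rewrite /char_poly_mx linearB /= tr_scalar_mx map_trmx.
Qed.

(** Full row and column rank force m = n. Over the polynomials G intertwines the characteristic
    matrices of A and of the transpose of A', and its determinant is a nonzero constant that can be
    cancelled. *)
Lemma char_poly_intertwine m n (A : 'M[F]_m) (A' : 'M[F]_n) (G : 'M[F]_(m, n)) :
  row_free G -> row_full G -> A *m G = G *m A'^T -> char_poly A = char_poly A'.
Proof.
rewrite /row_free /row_full => /eqP Gm /eqP Gn.
have mn : m = n := etrans (esym Gm) Gn.
case: n / mn A' G Gm {Gn} => A' G Gm AG; rewrite -(char_poly_tr A').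
have G0 : \det (map_mx polyC G) != 0.
  by rewrite det_map_mx polyC_eq0 -unitfE -unitmxE -row_free_unit /row_free Gm.
apply: (mulIf G0); rewrite /char_poly [RHS]mulrC -!det_mulmx; congr (\det _).
rewrite /char_poly_mx mulmxBl mulmxBr -!map_mxM AG; congr (_ - _).
by rewrite scalar_mxC.
Qed.

Variable V : vectType F.
Variables (U W : {vspace V}) (f : 'End(V)) (beta : V -> V -> F).
Hypotheses (fU : forall u, u \in U -> f u \in U) (fW : forall w, w \in W -> f w \in W).
Hypothesis betal : forall w a u v, beta (a *: u + v) w = a * beta u w + beta v w.
Hypothesis betar : forall w a u v, beta w (a *: u + v) = a * beta w u + beta w v.
Hypothesis beta_f : forall u w, beta (f u) w = beta u (f w).
Hypothesis nondeg_l : forall u, u \in U -> (forall w, w \in W -> beta u w = 0) -> u = 0.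
Hypothesis nondeg_r : forall w, w \in W -> (forall u, u \in U -> beta u w = 0) -> w = 0.

Lemma lrestrictE (U' : {vspace V}) (x : subvs_of U') :
  f (vsval x) \in U' -> vsval (lrestrict U' f x) = f (vsval x).
Proof. by move=> fx; rewrite /lrestrict !comp_lfunE !lfunE /= vsprojK. Qed.

Lemma beta_suml w (I : finType) (c : I -> F) (u : I -> V) :
  beta (\sum_i c i *: u i) w = \sum_i c i * beta (u i) w.
Proof.
have b0 : beta 0 w = 0.
  by apply: (addIr (beta 0 w)); rewrite add0r -[X in X + _]mul1r -betal scaler0 addr0.
by elim/big_rec2: _ => // i y x _ <-; rewrite betal.
Qed.

Lemma beta_sumr w (I : finType) (c : I -> F) (u : I -> V) :
  beta w (\sum_i c i *: u i) = \sum_i c i * beta w (u i).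
Proof.
have b0 : beta w 0 = 0.
  by apply: (addIr (beta w 0)); rewrite add0r -[X in X + _]mul1r -betar scaler0 addr0.
by elim/big_rec2: _ => // i y x _ <-; rewrite betar.
Qed.

(** In bases the pairing is a Gram matrix G, nondegeneracy on the two sides is full row and full
    column rank, and self-adjointness of f is the intertwining relation. *)
Lemma pairing_lchar_poly : lchar_poly (lrestrict U f) = lchar_poly (lrestrict W f).
Proof.
set e := vbasis {:subvs_of U}; set e' := vbasis {:subvs_of W}.
pose G := \matrix_(i, j) beta (vsval e`_i) (vsval e'`_j) :
  'M[F]_(\dim {:subvs_of U}, \dim {:subvs_of W}).
have expand (U' : {vspace V}) (x : subvs_of U') :
    vsval x = \sum_i coord (vbasis {:subvs_of U'}) i x *: vsval (vbasis {:subvs_of U'})`_i.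
  rewrite {1}(coord_vbasis (memvf x)) linear_sum; apply: eq_bigr => i _.
  by rewrite linearZ.
have mxofE (U' : {vspace V}) (h : 'End(subvs_of U')) i k :
    passmx.mxof (vbasis {:subvs_of U'}) (vbasis {:subvs_of U'}) h i k =
    coord (vbasis {:subvs_of U'}) k (h (vbasis {:subvs_of U'})`_i).
  by rewrite /passmx.mxof !mxE /= passmx.vecof_delta.
apply: (@char_poly_intertwine _ _ _ _ G).
- apply: inj_row_free => x xG.
  pose u := \sum_i x 0 i *: e`_i.
  have u0 : vsval u = 0.
    apply: nondeg_l => [|w wW]; first exact: subvsP.
    rewrite -(vsprojK wW) [vsval (vsproj W w)]expand beta_sumr big1 // => j _.
    rewrite linear_sum; under eq_bigr do rewrite linearZ.
    rewrite beta_suml; have := congr1 (fun y : 'rV_ _ => y 0 j) xG; rewrite !mxE => xGj.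
    by rewrite (eq_bigr (fun k => x 0 k * G k j)) ?xGj ?mulr0 // => k _; rewrite mxE.
  apply/rowP=> i; rewrite mxE.
  have <- : coord e i u = x 0 i by rewrite coord_sum_free // (basis_free (vbasisP _)).
  by rewrite (_ : u = 0) ?linear0 //; apply: val_inj.
- rewrite /row_full -mxrank_tr -/(row_free G^T); apply: inj_row_free => x xG.
  pose u := \sum_i x 0 i *: e'`_i.
  have u0 : vsval u = 0.
    apply: nondeg_r => [|w wU]; first exact: subvsP.
    rewrite -(vsprojK wU) [vsval (vsproj U w)]expand beta_suml big1 // => j _.
    rewrite linear_sum; under eq_bigr do rewrite linearZ.
    rewrite beta_sumr; have := congr1 (fun y : 'rV_ _ => y 0 j) xG; rewrite !mxE => xGj.
    by rewrite (eq_bigr (fun k => x 0 k * G^T k j)) ?xGj ?mulr0 // => k _; rewrite !mxE.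
  apply/rowP=> i; rewrite mxE.
  have <- : coord e' i u = x 0 i by rewrite coord_sum_free // (basis_free (vbasisP _)).
  by rewrite (_ : u = 0) ?linear0 //; apply: val_inj.
apply/matrixP=> i j; rewrite !mxE.
(* Entry (i, j) of either product is the pairing of f e_i with e'_j, expanded in the first argument
   or, once f has moved across, in the second. *)
transitivity (beta (f (vsval e`_i)) (vsval e'`_j)).
  rewrite -(lrestrictE (fU (subvsP _))) [vsval (lrestrict U f _)]expand beta_suml.
  by apply: eq_bigr => k _; rewrite mxofE !mxE.
rewrite beta_f -(lrestrictE (fW (subvsP _))) [vsval (lrestrict W f _)]expand beta_sumr.
by apply: eq_bigr => k _; rewrite [G i k]mxE [(_^T) k j]mxE mxofE mulrC.
Qed.
End CharPoly.

(** * Antiunitary maps *)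

Section Antiunitary.
Variables (R : realType) (N L : nat).
Local Notation C := R[i].
Local Notation hilb := (hilb R N L).

Lemma antiunitary_comp_l (U : 'End(hilb)) (T : hilb -> hilb) :
  unitary U -> antiunitary T -> antiunitary (fun v => U (T v)).
Proof.
move=> uU [Tl Tb Ti]; split.
- by move=> a u v; rewrite Tl linearP.
- apply: (bij_comp _ Tb); exists (adj U); [exact: unitaryK|exact: unitaryKV].
by move=> u v; rewrite (elimT (unitaryP U) uU) Ti.
Qed.

Lemma antiunitary_comp_r (U : 'End(hilb)) (T : hilb -> hilb) :
  unitary U -> antiunitary T -> antiunitary (fun v => T (U v)).
Proof.
move=> uU [Tl Tb Ti]; split.
- by move=> a u v; rewrite linearP Tl.
- apply: (bij_comp Tb); exists (adj U); [exact: unitaryK|exact: unitaryKV].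
by move=> u v; rewrite Ti (elimT (unitaryP U) uU).
Qed.

Lemma antiunitary_Kop : antiunitary (@Kop R N L).
Proof.
have KK : involutive (@Kop R N L) by move=> v; apply/ffunP=> b; rewrite !ffunE conjCK.
split; [|exact: inv_bij|].
  by move=> a u v; apply/ffunP=> b; rewrite !ffunE rmorphD rmorphM.
move=> u v; rewrite rmorph_sum; apply: eq_bigr => b _.
by rewrite !ffunE rmorphM.
Qed.
End Antiunitary.

(** * The Hamiltonian and its symmetries *)

Section Model.
Variables (R : realType) (N M L : nat).
Hypotheses (N_ge2 : (2 <= N)%N) (coMN : coprime M N) (L_ge3 : (3 <= L)%N).
Variable eta : 'Z_(2 * N).
Local Notation C := R[i].
Local Notation q := (q R N M).
Local Notation omega := (omega R N M).
Local Notation chi := (@chi R N M).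
Local Notation endM := 'M[C]_((Zp_trunc N).+2).
Local Notation Y := (Y R N M).
Local Notation hilb := (hilb R N L).
Local Notation on_site := (@on_site R N L).
Local Notation on_end := (@on_end R N L).
Local Notation E a b := (delta_mx a b : 'M[C]_2).
Local Notation f := (feta R eta).
Local Notation transl := (@transl R N L).
Local Notation Cop := (@Cop R N M L eta).
Local Notation Theta := (@Theta R N M L eta).
Local Notation charge := (@charge R N M L).
Local Notation bond := (@bond R N M L).
Local Notation seam := (@seam R N M L eta).
Local Notation ham s := (@ham R N M L eta s 0).
Local Notation Gplus := (@Gplus R N M L eta).
Local Notation Mplus := (@Mplus R N M L eta).
Local Notation Bop := (@Bop R N M L eta).
Local Notation g := ((Num.sqrt 2)%:C%C^-1 : C).

Lemma on_siteC (i j : 'Z_L) (a b : 'M[C]_2) : i != j ->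
  (on_site i a \o on_site j b = on_site j b \o on_site i a)%VF.
Proof.
move=> ij; rewrite /Defs.on_site !tensor_comp; apply: eq_tensor => k.
by case: (eqVneq k i) => [->|_]; rewrite ?(negbTE ij) ?mulr1 ?mul1r.
Qed.

Lemma on_site_endC (i : 'Z_L) (a : 'M[C]_2) (y : endM) :
  (on_site i a \o on_end y = on_end y \o on_site i a)%VF.
Proof.
rewrite /Defs.on_site /Defs.on_end !tensor_comp mulr1 mul1r.
by apply: eq_tensor => k; rewrite mulr1 mul1r.
Qed.

Lemma on_siteM (i : 'Z_L) (a b : 'M[C]_2) :
  (on_site i a \o on_site i b = on_site i (a * b))%VF.
Proof.
rewrite /Defs.on_site !tensor_comp mulr1; apply: eq_tensor => k.
by case: eqP; rewrite ?mulr1.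
Qed.

Lemma on_siteZ (i : 'Z_L) x (a : 'M[C]_2) : on_site i (x *: a) = x *: on_site i a.
Proof.
apply/lfunP=> v; apply/ffunP=> -[s n]; rewrite scale_lfunE ffunE !on_siteE.
by rewrite scaler_sumr; apply: eq_bigr => r _; rewrite mxE -mulrA.
Qed.

Lemma on_siteD (i : 'Z_L) (a b : 'M[C]_2) : on_site i (a + b) = on_site i a + on_site i b.
Proof.
apply/lfunP=> v; apply/ffunP=> -[s n]; rewrite add_lfunE ffunE !on_siteE.
by rewrite -big_split; apply: eq_bigr => r _; rewrite mxE mulrDl.
Qed.

Lemma on_endZ x (y : endM) : on_end (x *: y) = x *: on_end y.
Proof.
apply/lfunP=> v; apply/ffunP=> -[s n]; rewrite scale_lfunE ffunE !on_endE.
by rewrite scaler_sumr; apply: eq_bigr => r _; rewrite mxE -mulrA.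
Qed.

Lemma dag1 n : dag (1 : 'M[C]_n.+1) = 1.
Proof. by rewrite /dag map_mx1 trmx1. Qed.

Lemma adj_on_site (i : 'Z_L) (a : 'M[C]_2) : adj (on_site i a) = on_site i (dag a).
Proof.
rewrite /Defs.on_site adj_tensor dag1; apply: eq_tensor => k.
by case: eqP; rewrite ?dag1.
Qed.

Lemma adj_on_end (y : endM) : adj (on_end y) = on_end (dag y).
Proof. by rewrite /Defs.on_end adj_tensor; apply: eq_tensor => k; rewrite dag1. Qed.

Lemma on_end1 : on_end 1 = \1%VF.
Proof. exact: tensor1. Qed.

Section TwoSite.
Local Opaque Defs.on_site Defs.on_end.

(** The power of X is tied to the spins, so only the exponent of Z remains a parameter. *)
Definition pair (A B : 'Z_L) (a b a' b' : 'I_2) (e : int) : 'End(hilb) :=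
  (on_site A (E a a') \o on_site B (E b b') \o on_end (Y (flux a b a' b') e))%VF.

Implicit Types (k : 'I_2 -> 'I_2 -> 'I_2 -> 'I_2 -> C) (e : 'I_2 -> 'I_2 -> 'I_2 -> 'I_2 -> int).

Definition op2 (A B : 'Z_L) k e : 'End(hilb) :=
  sum4 (fun a b a' b' => k a b a' b' *: pair A B a b a' b' (e a b a' b')).

(** Exponents are compared on the support of k only: conjugation by C adds the flux to the exponent
    of Z in a bond, and the flux vanishes wherever [bcoef] does not. *)
Lemma eq_op2 A B k k' e e' :
  (forall a b a' b', k a b a' b' = k' a b a' b') ->
  (forall a b a' b', k a b a' b' != 0 -> e a b a' b' = e' a b a' b') ->
  op2 A B k e = op2 A B k' e'.
Proof.
move=> kk ee; apply: eq_sum4 => a b a' b'; rewrite -kk.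
case: (eqVneq (k a b a' b') 0) => [->|/ee ->//].
by rewrite !scale0r.
Qed.

Lemma op2_itw phi T A B A' B' k e k' e' : semilin phi T -> phi 1 = 1 ->
  (forall a b a' b',
    itw T (k a b a' b' *: pair A B a b a' b' (e a b a' b'))
          (k' a b a' b' *: pair A' B' a b a' b' (e' a b a' b'))) ->
  itw T (op2 A B k e) (op2 A' B' k' e').
Proof.
move=> Tlin phi1 h; apply: (sum4_ind2 (K := itw T)) => //.
  exact: (itw0 Tlin phi1).
by move=> *; apply: (itwD Tlin phi1).
Qed.

(** Reflection delivers the two sites in the reverse order; this puts them back. *)
Lemma op2_swap A B k e : A != B ->
  op2 A B k e = op2 B A (fun b a b' a' => k a b a' b') (fun b a b' a' => e a b a' b').
Proof.
move=> AB; rewrite /op2 [LHS]sum4_swap; apply: eq_sum4 => b a b' a'.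
congr (_ *: _); rewrite /pair (on_siteC (E a a') (E b b') AB).
have -> : flux a b a' b' = flux b a b' a' by rewrite /flux; ring.
by [].
Qed.

Lemma dagE a b : dag (E a b) = E b a.
Proof. by apply/matrixP=> i j; rewrite !mxE conjC_nat andbC. Qed.

Lemma adj_pair A B a b a' b' (e : int) : A != B ->
  adj (pair A B a b a' b' e) =
  omega ^ (flux a b a' b' * e) *: pair A B a' b' a b (- e).
Proof.
move=> AB; rewrite /pair !adj_comp !adj_on_site adj_on_end !dagE dagY // on_endZ.
rewrite -comp_lfunZl; congr (_ *: _).
have -> : flux a' b' a b = - flux a b a' b' by rewrite /flux; ring.
rewrite (on_siteC _ _ AB) -[RHS]comp_lfunA (on_site_endC A) [RHS]comp_lfunA.
by rewrite (on_site_endC B) -[RHS]comp_lfunA.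
Qed.

Lemma adj_op2 A B k e : A != B ->
  adj (op2 A B k e) =
  op2 A B (fun a b a' b' => (k a' b' a b)^* * omega ^ (flux a' b' a b * e a' b' a b))
          (fun a b a' b' => - e a' b' a b).
Proof.
move=> AB; rewrite [RHS]/op2 [RHS]sum4_transpose.
apply: (sum4_ind2 (K := fun x y => adj x = y)); first exact: adjop0.
  by move=> x y _ _ <- <-; rewrite adjopD.
by move=> a b a' b'; rewrite adjopZ adj_pair // scalerA.
Qed.

Lemma entryD (A B : 'End(hilb)) v b : (A + B) v b = A v b + B v b :> C.
Proof. by rewrite add_lfunE ffunE. Qed.
Lemma entry_sum4 (F : 'I_2 -> 'I_2 -> 'I_2 -> 'I_2 -> 'End(hilb)) v b :
  sum4 F v b = sum4 (fun a b' c d => F a b' c d v b) :> C.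
Proof.
apply: (sum4_ind2 (K := fun (x : 'End(hilb)) (y : C) => x v b = y)) => //.
  by rewrite zero_lfunE ffunE.
by move=> x y _ _ <- <-; rewrite entryD.
Qed.

Lemma pair0 A B a b a' b' : flux a b a' b' = 0 ->
  pair A B a b a' b' 0 = (on_site A (E a a') \o on_site B (E b b'))%VF.
Proof. by rewrite /pair => ->; rewrite Y00 on_end1 comp_lfun1r. Qed.

Lemma inord0 : inord 0 = 0 :> 'I_2. Proof. by apply: val_inj; rewrite /= inordK. Qed.
Lemma inord1 : inord 1 = 1 :> 'I_2. Proof. by apply: val_inj; rewrite /= inordK. Qed.

Lemma bondE j : bond j = op2 j (j + 1) (bcoef q) (fun _ _ _ _ => 0).
Proof.
transitivity (sum4 (fun a b a' b' => bcoef q a b a' b' *: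
    (on_site j (E a a') \o on_site (j + 1) (E b b'))%VF)).
  rewrite sum4_bcoef /bond.
  have -> : sigz R = E 0 0 + (-1) *: E 1 1.
    by apply/matrixP; apply: ord2_ind; apply: ord2_ind; rewrite !mxE /=; ring.
  rewrite !on_siteD !on_siteZ !(comp_lfunDl, comp_lfunDr) -!(comp_lfunZl, comp_lfunZr).
  by rewrite !scaleN1r opprK !addrA.
apply: eq_sum4 => a b a' b'.
have [->|k0] := eqVneq (bcoef q a b a' b') 0; first by rewrite !scale0r.
by rewrite pair0 ?(bcoef_flux k0).
Qed.

Lemma EY_pair A B (a b a' b' : 'I_2) (e : int) :
  @EY R N M L A B (2 * a + b) (2 * a' + b') (flux a b a' b') e = pair A B a b a' b' e.
Proof.
have h (x y : 'I_2) : inord (2 * x + y)./2 = x /\ inord (odd (2 * x + y)) = y.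
  by move: x y; do 2 (apply: ord2_ind); rewrite /= ?inord0 ?inord1.
by rewrite /EY /pair !(h _ _).1 !(h _ _).2.
Qed.

Lemma SbareE s A B :
  Sbare R N M s A B = op2 A B (fun a b a' b' => 2^-1 * scoef q s a b a' b') (sexp s).
Proof.
transitivity (sum4 (fun a b a' b' => (2^-1 * scoef q s a b a' b') *:
    @EY R N M L A B (2 * a + b) (2 * a' + b') (flux a b a' b') (sexp s a b a' b'))).
  by case: s; rewrite (sum4_scoef_plus, sum4_scoef_minus).
by apply: eq_sum4 => a b a' b'; rewrite EY_pair.
Qed.
End TwoSite.

Let v0 : nat_of_ord (0 : 'I_2) = 0%N. Proof. by []. Qed.
Let v1 : nat_of_ord (1 : 'I_2) = 1%N. Proof. by []. Qed.

Lemma diag2_E x y a b : diag2 x y * E a b = diagc x y a *: E a b.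
Proof.
apply/matrixP=> i j; rewrite -[LHS]/((diag2 x y *m E a b) i j) mul_diag_mx !mxE /diagc.
by have [->|_] := eqVneq i a; rewrite ?mulr0.
Qed.

Lemma E_diag2 x y a b : E a b * diag2 x y = diagc x y b *: E a b.
Proof.
apply/matrixP=> i j; rewrite -[LHS]/((E a b *m diag2 x y) i j) mul_mx_diag !mxE /diagc mulrC.
by have [->|_] := eqVneq j b; rewrite ?andbF ?mulr0.
Qed.

Lemma diag2M x y z t : diag2 x y * diag2 z t = diag2 (x * z) (y * t) :> 'M[C]_2.
Proof.
apply/matrixP=> i j; rewrite -[LHS]/((diag2 x y *m diag2 z t) i j) mul_diag_mx !mxE.
by rewrite mulrnAr; case: (i == j) => //; case: (i == 0).
Qed.

Lemma diag2_1 : diag2 1 1 = 1 :> 'M[C]_2.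
Proof. by apply/matrixP=> i j; rewrite !mxE; case: (i == 0). Qed.

Lemma dag_diag2 x y : dag (diag2 x y) = diag2 x^* y^* :> 'M[C]_2.
Proof.
apply/matrixP=> i j; rewrite !mxE rmorphMn /= (eq_sym j i).
by case: (eqVneq i j) => [->|_] //; case: (j == 0).
Qed.

(** F on site B commutes with the factors on site A and on the endpoint, so it only rescales
    E_(bb'), by f to the power [sexp] in either branch. *)
Lemma seamE s A B : A != B -> seam s A B = op2 A B (kseam q f s) (sexp s).
Proof.
move=> AB; rewrite /Defs.seam SbareE adj_on_site.
apply: (sum4_ind2 (K := fun x y =>
  (on_site B (Fout R s eta) \o x \o on_site B (dag (Fout R s eta)))%VF = y)).
- by rewrite comp_lfun0r comp_lfun0l.
- by move=> x y _ _ <- <-; rewrite comp_lfunDr comp_lfunDl.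
move=> a b a' b'.
rewrite -comp_lfunZr -comp_lfunZl /kseam -[RHS]scalerA; congr (_ *: _).
have BA : B != A by rewrite eq_sym.
have FE : Fout R s eta * E b b' * dag (Fout R s eta) = f ^ sexp s a b a' b' *: E b b'.
  have f0 := feta_neq0 R eta.
  case: s; rewrite /Fout dag_diag2 diag2_E -scalerAl E_diag2 scalerA; congr (_ *: _).
    rewrite conjC1 conj_feta /sexp /diagc; move: b b'; do 2 (apply: ord2_ind);
    by rewrite ?v0 ?v1 ?eqxx ?subrr ?sub0r ?subr0 /= ?mul1r ?mulr1 ?divff ?exprN1.
  rewrite conjC1 conj_feta /sexp /diagc; move: b b'; do 2 (apply: ord2_ind);
  by rewrite ?v0 ?v1 ?eqxx ?subrr ?sub0r ?subr0 /= ?mul1r ?mulr1 ?divff ?exprN1.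
transitivity (on_site A (E a a') \o on_site B (f ^ sexp s a b a' b' *: E b b') \o
    on_end (Y (flux a b a' b') (sexp s a b a' b')))%VF; last first.
  by rewrite on_siteZ -comp_lfunZr -comp_lfunZl.
rewrite -FE -!on_siteM -!comp_lfunA (on_site_endC B (dag _)).
by rewrite [LHS]comp_lfunA (on_siteC _ _ BA) -[LHS]comp_lfunA.
Qed.

Lemma itw_pair phi T A B A' B' a b a' b' c d c' d' (e e' : int) x y z :
  semilin phi T -> phi 1 = 1 ->
  itw T (on_site A (E a a')) (x *: on_site A' (E c c')) ->
  itw T (on_site B (E b b')) (y *: on_site B' (E d d')) ->
  itw T (on_end (Y (flux a b a' b') e)) (z *: on_end (Y (flux c d c' d') e')) ->
  itw T (pair A B a b a' b' e) ((x * y * z) *: pair A' B' c d c' d' e').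
Proof.
move=> Tl T1 hA hB hY.
have := itw_comp (itw_comp hA hB) hY.
have -> // : ((x *: on_site A' (E c c') \o y *: on_site B' (E d d')) \o
    z *: on_end (Y (flux c d c' d') e'))%VF = (x * y * z) *: pair A' B' c d c' d' e'.
by rewrite -!(comp_lfunZl, comp_lfunZr) !scalerA; congr (_ *: _); ring.
Qed.

(** * Translation and reflection of local operators *)

Lemma transl_site j a : itw transl (on_site j a) (on_site (j + 1) a).
Proof.
apply/itw_lfun; rewrite /Defs.transl /Defs.on_site.
rewrite (@site_op_tensor R N L _ (fun j => j + 1)); last 2 first.
- exact: subrK.
- exact: addrK.
by congr (_ \o _)%VF; apply: eq_tensor => i; rewrite subr_eq.
Qed.

Lemma transl_end y : itw transl (on_end y) (on_end y).
Proof.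
apply/itw_lfun; rewrite /Defs.transl /Defs.on_end.
by rewrite (@site_op_tensor R N L _ (fun j => j + 1)) //; [exact: subrK|exact: addrK].
Qed.

Lemma transl_op2 A B k e : itw transl (op2 A B k e) (op2 (A + 1) (B + 1) k e).
Proof.
have Tl := semilin_lfun transl.
apply: (op2_itw Tl) => // a b a' b'; apply: (itwZ Tl) => //.
exact: (itw_comp (itw_comp (transl_site A (E a a')) (transl_site B (E b b'))) (transl_end _)).
Qed.

Lemma refl_site j a : itw (@refl R N L) (on_site j a) (on_site (- 1 - j) a).
Proof.
apply/itw_lfun; rewrite /Defs.refl /Defs.on_site.
rewrite (@site_op_tensor R N L _ (fun j => - 1 - j)); try by move=> i; rewrite subKr.
by congr (_ \o _)%VF; apply: eq_tensor => i; rewrite subr_eq addrC -subr_eq eq_sym.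
Qed.

Lemma refl_end y : itw (@refl R N L) (on_end y) (on_end y).
Proof.
apply/itw_lfun; rewrite /Defs.refl /Defs.on_end.
by rewrite (@site_op_tensor R N L _ (fun j => - 1 - j)) //; move=> i; rewrite subKr.
Qed.

Lemma tensor_site D (y : endM) j a a' : D j * a = a' * D j ->
  itw (tensor D y : 'End(hilb)) (on_site j a) (on_site j a').
Proof.
move=> Da; apply/itw_lfun; rewrite /Defs.on_site !tensor_comp mulr1 mul1r.
by apply: eq_tensor => i; case: eqP => [->|_]; rewrite ?mulr1 ?mul1r.
Qed.

Lemma tensor_end D (y z z' : endM) : y * z = z' * y ->
  itw (tensor D y : 'End(hilb)) (on_end z) (on_end z').
Proof.
move=> yz; apply/itw_lfun; rewrite /Defs.on_end !tensor_comp yz.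
by apply: eq_tensor => i; rewrite mulr1 mul1r.
Qed.

(** * Conjugation by C *)

Definition tilt (j : 'Z_L) : int := (2 * L)%:Z - (delta N)%:Z - (2 * j)%:Z.

(** Conjugating E_(aa') by a diagonal matrix sees only the quotient of two diagonal entries, in
    which the half-angles add up to an integer power of q. *)
Lemma qsz_ratio (t : int) (x : R) : x = t%:~R ->
  cis (pi * M%:R * x / (2 * N%:R)) = q ^ t * cis (- (pi * M%:R * x / (2 * N%:R))) :> C.
Proof.
move=> ->.
have cisz (u : R) (k : int) : cis u ^ k = cis (u *~ k).
  by case: k => n; [exact: cisX|rewrite NegzE -exprnN cisX mulrNz cisN].
have -> : q ^ t = cis (pi / N%:R *+ M *~ t).
  by rewrite /Defs.q /eps cisX cisz.
rewrite -cisD; congr cis; rewrite -mulrzl -mulr_natl.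
have : N%:R != 0 :> R by rewrite pnatr_eq0 -lt0n ltnW.
by move=> ?; field.
Qed.

Definition Cdiag j : 'M[C]_2 :=
  Fout R Plus eta * qsz N M ((2 * L)%:R - (delta N)%:R - (2 * j)%:R).

Lemma CopE :
  Cop = (tensor Cdiag (X R N ^ (- L%:Z - 1) * P R N M) \o @refl R N L)%VF.
Proof. by rewrite /Defs.Cop /C0op comp_lfunA tensor_comp mul1r. Qed.

Lemma Cop_site j a a' :
  let i := - 1 - j in
  itw Cop (on_site j (E a a'))
    ((f ^ (a%:Z - a'%:Z) * q ^ (tilt i * (a'%:Z - a%:Z))) *: on_site i (E a a')).
Proof.
move=> i; rewrite CopE; apply/itw_lfun; move/itw_lfun: (refl_site j (E a a')) => rj.
rewrite -comp_lfunA rj !comp_lfunA; congr (_ \o _)%VF; apply/itw_lfun.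
rewrite -on_siteZ; apply: tensor_site.
rewrite /Cdiag -/i /Fout /qsz diag2M diag2_E -scalerAl E_diag2 scalerA.
congr (_ *: _); rewrite /diagc.
rewrite (@qsz_ratio (tilt i)); last by rewrite /tilt !rmorphB.
have f0 := feta_neq0 R eta; have := expfz_neq0 (tilt i) (q_neq0 R N M).
clear rj.
move: (tilt i) (cis (- _)) => t c qt0.
move: a a'; do 2 (apply: ord2_ind).
all: rewrite ?v0 ?v1 /= ?subrr ?sub0r ?subr0.
all: rewrite ?mulr1 ?mulr0 ?expr0z ?mul1r ?mulrN1 ?exprN1 -?invr_expz //.
all: by field.
Qed.

Lemma Cop_end (a e : int) :
  itw Cop (on_end (Y a e))
    (q ^ (a * (a - (delta N)%:Z) + 2 * ((a + e) * (L%:Z + 1))) *: on_end (Y a (a + e))).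
Proof.
rewrite CopE; apply/itw_lfun; move/itw_lfun: (refl_end (Y a e)) => rj.
rewrite -comp_lfunA rj !comp_lfunA; congr (_ \o _)%VF; apply/itw_lfun.
rewrite -on_endZ; apply: tensor_end; rewrite XP_Y // scalerAl; congr (_ ^ _ *: _ * _).
by ring.
Qed.

Lemma Cop_op2 A B k e :
  itw Cop (op2 A B k e)
   (op2 (- 1 - A) (- 1 - B)
     (fun a b a' b' => let m := flux a b a' b' in
        k a b a' b' * (f ^ m * q ^ (tilt (- 1 - A) * (a'%:Z - a%:Z)
        + tilt (- 1 - B) * (b'%:Z - b%:Z)
        + m * (m - (delta N)%:Z) + 2 * ((m + e a b a' b') * (L%:Z + 1)))))
     (fun a b a' b' => flux a b a' b' + e a b a' b')).
Proof.
have Cl := semilin_lfun Cop.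
apply: (op2_itw Cl) => // a b a' b' /=; rewrite -scalerA; apply: (itwZ Cl) => //.
have := itw_pair Cl erefl (Cop_site A a a') (Cop_site B b b')
  (Cop_end (flux a b a' b') (e a b a' b')).
congr (itw _ _ (_ *: _)).
have f0 := feta_neq0 R eta; have q0 := q_neq0 R N M.
have -> : flux a b a' b' = (a%:Z - a'%:Z) + (b%:Z - b'%:Z) by rewrite /flux; ring.
by rewrite !(expfzDr _ _ f0) !(expfzDr _ _ q0); ring.
Qed.

Let L_gt1 : (1 < L)%N. Proof. exact: ltnW. Qed.

Lemma site_ltn (j : 'Z_L) : (j < L)%N.
Proof. by rewrite -[X in (_ < X)%N](Zp_cast L_gt1). Qed.

Lemma nat_opp1 : nat_of_ord (-1 : 'Z_L)%R = L.-1.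
Proof.
have -> : (-1 : 'Z_L) = L.-1%:R.
  by apply/eqP; rewrite eq_sym -subr_eq0 opprK natr1 prednK ?pchar_Zp // ltnW.
by rewrite val_Zp_nat // modn_small // prednK // ltnW.
Qed.

Lemma nextN (j : 'Z_L) : j != j + 1.
Proof. by rewrite -[X in X != _]addr0 (inj_eq (addrI j)) eq_sym oner_neq0. Qed.

Lemma last_neq0 : (0 - 1 : 'Z_L) != 0.
Proof. by rewrite sub0r oppr_eq0 oner_neq0. Qed.

(** At i = -1 the representative wraps from L - 1 to 0; that bond is the one absent from the sum
    when the seam is at position 0. *)
Lemma tiltS (i : 'Z_L) : i != -1 -> tilt (i + 1) = tilt i - 2.
Proof.
move=> i1; have -> : i + 1 = i.+1%:R by rewrite -natr1 natr_Zp.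
have iL : (i.+1 < L)%N.
  rewrite ltn_neqAle site_ltn andbT; apply: contra i1 => /eqP e.
  by apply/eqP/val_inj/(etrans _ (esym nat_opp1))/(congr1 predn e).
by rewrite /tilt val_Zp_nat // modn_small //; lia.
Qed.

(** At zero flux the factors from f, P_N and X^(-L-1) are trivial, and the tilts enter only through
    their difference 2, the power of q in [bcoef_reflect]. *)
Lemma Cop_bond (j : 'Z_L) : j != -1 -> itw Cop (bond j) (bond (- 1 - (j + 1))).
Proof.
move=> j1; set i := - 1 - (j + 1).
have ij : -1 - j = i + 1 by rewrite /i; ring.
have i1 : i != -1.
  apply: contra j1 => /eqP e; have -> : j = -1 - i - 1 by rewrite /i; ring.
  by rewrite e; apply/eqP; ring.
have := Cop_op2 j (j + 1) (bcoef q) (fun _ _ _ _ => 0).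
rewrite -/i ij !bondE [X in _ -> itw _ _ X]op2_swap //; last exact: nextN.
congr itw; apply: eq_op2 => a b a' b'; cbv zeta.
  have [k0|k0] := eqVneq (bcoef q a b a' b') 0.
    by rewrite k0 mul0r -[RHS](bcoef_reflect (q_neq0 R N M)) k0 mul0r.
  rewrite -[RHS](bcoef_reflect (q_neq0 R N M)) tiltS // (bcoef_flux k0) expr0z mul1r.
  congr (_ * _ ^ _).
  have -> : b'%:Z - b%:Z = a%:Z - a'%:Z by have := bcoef_flux k0; rewrite /flux; lia.
  by ring.
by rewrite mulf_eq0 negb_or => /andP[/bcoef_flux ->].
Qed.

(** The exponent of Z becomes a - a', that of the plus branch with the sites exchanged. The tilts at
    the seam sites are 2L - delta and 2 - delta: delta cancels against P_N, and 2L against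
    X^(-L-1). *)
Lemma Cop_seam : itw Cop (seam Minus (0 - 1) 0) (seam Plus (0 - 1) 0).
Proof.
have AB := last_neq0; rewrite !seamE //.
have := Cop_op2 (0 - 1) 0 (kseam q f Minus) (sexp Minus).
have -> : -1 - (0 - 1) = 0 :> 'Z_L by ring.
have -> : -1 - 0 = 0 - 1 :> 'Z_L by ring.
rewrite [X in _ -> itw _ _ X]op2_swap //.
congr itw; apply: eq_op2 => a b a' b'; last by rewrite /flux /sexp => _; ring.
have t0 : tilt 0 = 2 * L%:Z - (delta N)%:Z by rewrite /tilt /=; lia.
have t1 : tilt (0 - 1) = 2 - (delta N)%:Z.
  by rewrite /tilt sub0r nat_opp1; lia.
rewrite /kseam -(scoef_reflect (q_neq0 R N M)) t0 t1 /=.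
have f0 := feta_neq0 R eta; have q0 := q_neq0 R N M.
rewrite -!mulrA; congr (_ * (_ * _)).
have powers (x y : C) (i j k l m : int) : x != 0 -> i + j = m -> k = l ->
    x ^ i * (x ^ j * y ^ k) = y ^ l * x ^ m.
  by move=> x0 <- ->; rewrite (expfzDr _ _ x0); ring.
by apply: powers => //; rewrite /flux; ring.
Qed.

Lemma Cop_ham : itw Cop (ham Minus) (ham Plus).
Proof.
have Cl := semilin_lfun Cop; apply: (itwD Cl) => //; last exact: Cop_seam.
(* Reflection acts on bond labels by this involution, which fixes the seam bond -1. *)
rewrite [X in itw _ _ X](reindex (fun j : 'Z_L => - 1 - (j + 1))) /=; last first.
  by exists (fun j : 'Z_L => - 1 - (j + 1)) => j _; ring.
rewrite [X in itw _ _ X](eq_bigl (fun j : 'Z_L => j != 0 - 1)); last first.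
  move=> j; congr negb; apply/eqP/eqP => [h|->]; last by ring.
  have -> : j = -1 - (-1 - (j + 1)) - 1 by ring.
  by rewrite h; ring.
apply: (itw_sum Cl) => // j; rewrite sub0r; exact: Cop_bond.
Qed.

(** * Conjugation by Theta *)

Lemma Kop_tensor a (y : endM) (v : hilb) :
  Kop (tensor a y v) = tensor (fun j => map_mx Num.conj (a j)) (map_mx Num.conj y) (Kop v).
Proof.
apply/ffunP=> b; rewrite ffunE !mxopE rmorph_sum; apply: eq_bigr => c _.
rewrite !rmorphM rmorph_prod !ffunE mxE; congr (_ * _ * _).
by apply: eq_bigr => j _; rewrite mxE.
Qed.

Lemma semilin_Theta : semilin Num.conj Theta.
Proof.
move=> k u v; rewrite /Defs.Theta -linearP; congr (_ _).
by apply/ffunP=> b; rewrite !ffunE rmorphD rmorphM.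
Qed.

Lemma sigxE i j : sigx R i j = (i == rev_ord j)%:R.
Proof. by move: i j; do 2 (apply: ord2_ind); rewrite !mxE /= ?addr0 ?add0r. Qed.

Lemma sigx_E a a' : sigx R * E a a' = E (rev_ord a) (rev_ord a') * sigx R.
Proof.
apply/matrixP=> i j; rewrite -[LHS]/((sigx R *m E a a') i j) -[RHS]/((_ *m sigx R) i j) !mxE.
under eq_bigr do rewrite sigxE !mxE.
under [in RHS]eq_bigr do rewrite sigxE !mxE.
rewrite (bigD1 (rev_ord i)) //= rev_ordK eqxx mul1r big1 ?addr0; last first.
  move=> k ki; rewrite (_ : (i == _) = false) ?mul0r //.
  by apply/negbTE; apply: contra ki => /eqP ->; rewrite rev_ordK.
rewrite (bigD1 (rev_ord j)) //= eqxx mulr1 big1 ?addr0; last first.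
  by move=> k /negbTE ki; rewrite ki mulr0.
by rewrite (can2_eq (@rev_ordK 2) (@rev_ordK 2)) (inj_eq rev_ord_inj).
Qed.

Lemma Kop_site j a a' (v : hilb) :
  Kop (on_site j (E a a') v) = on_site j (E a a') (Kop v).
Proof.
rewrite Kop_tensor map_mx1 (@eq_tensor R N L _ (fun i => if i == j then E a a' else 1)) //.
by move=> i; case: eqP => _; rewrite ?map_mx1 // map_delta_mx.
Qed.

Lemma Kop_end (y : endM) (v : hilb) : Kop (on_end y v) = on_end (map_mx Num.conj y) (Kop v).
Proof.
by rewrite Kop_tensor (@eq_tensor R N L _ (fun=> 1)) // => i; rewrite map_mx1.
Qed.

Lemma Theta_site j a a' :
  itw Theta (on_site j (E a a')) (on_site j (E (rev_ord a) (rev_ord a'))).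
Proof. by move=> v; rewrite /Defs.Theta Kop_site (tensor_site _ (sigx_E a a')). Qed.

(** The scalar is chi kappa ^ (-e), the reason for the shift X^kappa: conjugating a seam coefficient
    turns f^e into f^(-e), and the product is f^e again. *)
Lemma Theta_end (a e : int) : itw Theta (on_end (Y a e)) (f ^ (2 * e) *: on_end (Y (- a) e)).
Proof.
move=> v; rewrite /Defs.Theta Kop_end -on_endZ.
apply: tensor_end; rewrite XJ_Y // -scalerAl; congr (_ *: _).
by rewrite chi_kappa // exprnN exprz_exp mulNr mulrN opprK.
Qed.

Lemma Theta_op2 A B k e :
  itw Theta (op2 A B k e)
   (op2 A B
     (fun a b a' b' =>
        (k (rev_ord a) (rev_ord b) (rev_ord a') (rev_ord b'))^* *
          f ^ (2 * e (rev_ord a) (rev_ord b) (rev_ord a') (rev_ord b')))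
     (fun a b a' b' => e (rev_ord a) (rev_ord b) (rev_ord a') (rev_ord b'))).
Proof.
have Tl := semilin_Theta; rewrite [X in itw _ _ X]/op2 sum4_flip.
apply: (sum4_ind2 (K := itw Theta)).
- by apply: (itw0 Tl); rewrite conjC1.
- by move=> *; apply: (itwD Tl) => //; rewrite conjC1.
move=> a b a' b'; rewrite !rev_ordK -scalerA; apply: (itwZ Tl); first by rewrite conjC1.
have := itw_pair (x := 1) (y := 1) (e' := e a b a' b') Tl (conjC1 _).
move=> /(_ A B A B a b a' b' (rev_ord a) (rev_ord b) (rev_ord a') (rev_ord b')).
move=> /(_ (e a b a' b') (f ^ (2 * e a b a' b'))).
rewrite !scale1r mul1r => h; rewrite -[f ^ _]mul1r; apply: h; try exact: Theta_site.
by rewrite flux_flip; exact: Theta_end.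
Qed.

Lemma Theta_bond j : itw Theta (bond j) (bond j).
Proof.
have := Theta_op2 j (j + 1) (bcoef q) (fun _ _ _ _ => 0).
rewrite !bondE //; congr itw; apply: eq_op2 => // a b a' b'.
by rewrite map_bcoef mulr0 expr0z mulr1 /= conj_q bcoef_flip.
Qed.

Lemma conj_half : (2^-1 : C)^* = 2^-1.
Proof. by rewrite fmorphV rmorph_nat. Qed.

Lemma conj_kseam s a b a' b' : (kseam q f s a b a' b')^* =
  2^-1 * scoef q^-1 s a b a' b' * f ^ (- sexp s a b a' b').
Proof.
have cs : (scoef q s a b a' b')^* = scoef q^-1 s a b a' b'.
  by rewrite -conj_q; exact: map_scoef.
have cM (x y : C) : (x * y)^* = x^* * y^* by exact: rmorphM.
by rewrite /kseam !cM cs conj_half conjCXz conj_feta exprz_inv.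
Qed.

Lemma Theta_seam A B : A != B -> itw Theta (seam Plus A B) (seam Minus A B).
Proof.
move=> AB; have := Theta_op2 A B (kseam q f Plus) (sexp Plus).
rewrite !seamE //; congr itw; apply: eq_op2 => a b a' b' *; last exact: sexp_flip.
rewrite conj_kseam scoef_flip sexp_flip /kseam -[LHS]mulrA; congr (_ * _).
by rewrite -expfzDr ?feta_neq0 //; apply: congr1; ring.
Qed.

Lemma Theta_ham : itw Theta (ham Plus) (ham Minus).
Proof.
have Tl := semilin_Theta; apply: (itwD Tl); rewrite ?conjC1 //.
  by apply: (itw_sum Tl); rewrite ?conjC1 // => j _; exact: Theta_bond.
exact/Theta_seam/last_neq0.
Qed.

(** * Self-adjointness of the Hamiltonian *)

Lemma adj_bond j : adj (bond j) = bond j.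
Proof.
rewrite bondE // adj_op2 //; last exact: nextN.
apply: eq_op2 => a b a' b'; last by rewrite oppr0.
by rewrite map_bcoef /= mulr0 expr0z mulr1 conj_q bcoef_adj.
Qed.

Lemma sexp_transpose s a b a' b' : sexp s a' b' a b = - sexp s a b a' b'.
Proof. by case: s; rewrite /sexp opprB. Qed.

Lemma adj_seam s A B : A != B -> adj (seam s A B) = seam s A B.
Proof.
move=> AB; rewrite seamE // adj_op2 //.
apply: eq_op2 => a b a' b'; last by rewrite sexp_transpose opprK.
rewrite conj_kseam sexp_transpose opprK /kseam -[in RHS](scoef_adj (q_neq0 R N M)).
have -> z : omega ^ z = q ^ (2 * z) by rewrite -exprz_exp.
by rewrite [in RHS](sexp_transpose s a b a' b') -!mulrA (mulrC (f ^ _)).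
Qed.

Lemma adj_ham s : adj (ham s) = ham s.
Proof.
rewrite /Defs.ham adjopD adj_sum adj_seam ?last_neq0 //; congr (_ + _).
by apply: eq_bigr => j _; rewrite adj_bond.
Qed.

(** * Charge conservation *)

Lemma charge_site j a a' :
  itw charge (on_site j (E a a')) (omega ^ (a%:Z - a'%:Z) *: on_site j (E a a')).
Proof.
rewrite -on_siteZ; apply: tensor_site.
rewrite diag2_E -scalerAl E_diag2 scalerA; congr (_ *: _).
have o0 := omega_neq0 R N M.
move: a a'; do 2 (apply: ord2_ind); rewrite /diagc /=; eval_powers; by field.
Qed.

Lemma charge_end (a e : int) :
  itw charge (on_end (Y a e)) (omega ^ (- a) *: on_end (Y a e)).
Proof.
rewrite -on_endZ; apply: tensor_end.
have -> : Z R N M ^ (-1) = Y 0 (-1) by rewrite /Defs.Y expr0z mul1r.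
by rewrite -scalerAl !YM // mulN1r mulr0 expr0z scale1r add0r addr0 (addrC e).
Qed.

(** The two sites together contribute omega ^ flux, and the endpoint its inverse. *)
Lemma charge_op2 A B k e : itw charge (op2 A B k e) (op2 A B k e).
Proof.
have Cl := semilin_lfun charge.
apply: (op2_itw Cl) => // a b a' b'; apply: (itwZ Cl) => //.
have := itw_pair Cl erefl (charge_site A a a') (charge_site B b b')
  (charge_end (flux a b a' b') (e a b a' b')).
congr (itw _ _ _); rewrite -!expfzDr ?omega_neq0 // (_ : _ + _ = 0) ?expr0z ?scale1r //.
by rewrite /flux; ring.
Qed.

Lemma charge_ham s : itw charge (ham s) (ham s).
Proof.
have Cl := semilin_lfun charge; apply: (itwD Cl) => //.
  by apply: (itw_sum Cl) => // j _; rewrite bondE //; exact: charge_op2.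
by rewrite seamE ?last_neq0 //; exact: charge_op2.
Qed.

(** * Moving the seam with the gate *)

Lemma Lplus_Y (a b : 'I_2) :
  Lplus R N M a b = lcoef q a b *: Y (a%:Z - b%:Z) a.
Proof.
move: a b; do 2 (apply: ord2_ind); rewrite /Lplus /lcoef /= /Defs.Y.
all: by rewrite ?subrr ?sub0r ?subr0 ?expr0z ?mulr1 ?mul1r ?scale1r.
Qed.

Section Window.
Variables (A B : 'Z_L) (s : {ffun 'Z_L -> 'I_2}) (n : 'Z_N).
Hypothesis AB : A != B.

(* Amplitudes of v along the configurations which agree with s outside of the
   sites A and B; the endpoint label is measured from n. *)
Definition win (v : hilb) (a b : 'I_2) (k : int) : C :=
  v (upd (upd s A a) B b, n + k%:~R).

Lemma winD u v a b k : win (u + v) a b k = win u a b k + win v a b k.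
Proof. by rewrite /win ffunE. Qed.
Lemma winN v a b k : win (- v) a b k = - win v a b k.
Proof. by rewrite /win ffunE. Qed.
Lemma winZ x v a b k : win (x *: v) a b k = x * win v a b k.
Proof. by rewrite /win ffunE. Qed.

Lemma win_sum4 (F : 'I_2 -> 'I_2 -> 'I_2 -> 'I_2 -> 'End(hilb)) v a b k :
  win (sum4 F v) a b k = sum4 (fun c d c' d' => win (F c d c' d' v) a b k).
Proof. exact: entry_sum4. Qed.

Lemma win_siteA (x : 'M[C]_2) v a b k :
  win (on_site A x v) a b k = x a 0 * win v 0 b k + x a 1 * win v 1 b k.
Proof.
rewrite /win on_siteE big_ord_recl big_ord1 !ffunE (negbTE AB) eqxx.
have e r : upd (upd (upd s A a) B b) A r = upd (upd s A r) B b.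
  apply/ffunP=> i; rewrite !ffunE.
  by case: (eqVneq i A) => [->|//]; rewrite (negbTE AB).
by rewrite !e; congr (_ + x a _ * v (upd (upd s A _) _ _, _)); apply: val_inj.
Qed.

Lemma win_siteB (x : 'M[C]_2) v a b k :
  win (on_site B x v) a b k = x b 0 * win v a 0 k + x b 1 * win v a 1 k.
Proof.
rewrite /win on_siteE big_ord_recl big_ord1 !ffunE eqxx.
have e r : upd (upd (upd s A a) B b) B r = upd (upd s A a) B r.
  by apply/ffunP=> i; rewrite !ffunE; case: eqP.
by rewrite !e; congr (_ + x b _ * v (upd _ _ _, _)); apply: val_inj.
Qed.

Lemma win_end (p l : int) v a b k :
  win (on_end (Y p l) v) a b k =
  chi n ^ l * q ^ (2 * (l * (k - p))) * win v a b (k - p).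
Proof.
rewrite /win on_endE.
have e i : (n + k%:~R == i + p%:~R) = (i == n + (k - p)%:~R).
  by rewrite rmorphB /= addrA [RHS]eq_sym subr_eq.
under eq_bigr do rewrite YE // e -mulrA.
rewrite sum_delta chiD // expfzMl chi_zq // exprz_exp; congr (_ * _ ^ _ * _); ring.
Qed.

Lemma win_EA c d v a b k :
  win (on_site A (E c d) v) a b k = (a == c)%:R * win v d b k.
Proof.
rewrite win_siteA !mxE; move: d; apply: ord2_ind;
  by rewrite ?andbT ?andbF mul0r ?addr0 ?add0r.
Qed.

Lemma win_EB c d v a b k :
  win (on_site B (E c d) v) a b k = (b == c)%:R * win v a d k.
Proof.
rewrite win_siteB !mxE; move: d; apply: ord2_ind;
  by rewrite ?andbT ?andbF mul0r ?addr0 ?add0r.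
Qed.

(** Passage from operators to [op2f]: at the label n + (z - m), Z^l has the value x^l q^(2l(z-m))
    with x = chi n. *)
Lemma win_op2 k e v a b z :
  win (op2 A B k e v) a b z = op2f q (chi n) k e (win v) a b z.
Proof.
rewrite win_sum4; transitivity (sum4 (fun c d c' d' => (a == c)%:R * ((b == d)%:R *
    (let m := flux c d c' d' in let l := e c d c' d' in
     k c d c' d' * (chi n ^ l * q ^ (2 * (l * (z - m))) * win v c' d' (z - m))))));
  last exact: sum2_delta.
apply: eq_sum4 => c d c' d'.
rewrite scale_lfunE winZ /pair !comp_lfunE win_EA win_EB win_end.
by cbv zeta; ring.
Qed.

Lemma win_zdiagB x y v a b k :
  win (on_site B (diag2 x y) v) a b k = diagc x y b * win v a b k.
Proof.
rewrite win_siteB /diagc; move: b; apply: ord2_ind; rewrite !mxE /= ?mulr0n ?mulr1n; ring.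
Qed.

Lemma win_zdiagA x y v a b k :
  win (on_site A (diag2 x y) v) a b k = diagc x y a * win v a b k.
Proof.
rewrite win_siteA /diagc; move: a; apply: ord2_ind; rewrite !mxE /= ?mulr0n ?mulr1n; ring.
Qed.

Lemma win_sum (u : 'I_2 -> hilb) a b z :
  win (\sum_i u i) a b z = \sum_i win (u i) a b z.
Proof. exact: sum_ffunE. Qed.

Lemma win_termB d v a b z :
  win ((on_site B (E b d) \o on_end (Lplus R N M b d))%VF v) a b z =
  lcoef q b d *
    (chi n ^ b * q ^ (2 * (b%:Z * (z - (b%:Z - d%:Z)))) * win v a d (z - (b%:Z - d%:Z))).
Proof.
by rewrite comp_lfunE win_EB eqxx mul1r Lplus_Y on_endZ scale_lfunE winZ win_end.
Qed.

Lemma win_GB v a b z : win (Gplus B v) a b z = gateB q (chi n) f g (win v) a b z.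
Proof.
rewrite /Defs.Gplus /Fout comp_lfunE win_zdiagB scale_lfunE winZ sum_lfunE win_sum.
rewrite (bigD1 b) //= [X in _ + X]big1 ?addr0 => [|r rb].
  rewrite sum_lfunE win_sum big_ord_recl big_ord1.
  rewrite (_ : lift ord0 ord0 = 1); last exact: val_inj.
  by rewrite (win_termB ord0) (win_termB 1) /gateB -!mulrA mulrCA.
rewrite sum_lfunE win_sum big1 // => s0 _.
by rewrite comp_lfunE win_EB eq_sym (negbTE rb) mul0r.
Qed.

Lemma win_termA d v a b z :
  win ((on_site A (E a d) \o on_end (Lplus R N M a d))%VF v) a b z =
  lcoef q a d *
    (chi n ^ a * q ^ (2 * (a%:Z * (z - (a%:Z - d%:Z)))) * win v d b (z - (a%:Z - d%:Z))).
Proof.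
by rewrite comp_lfunE win_EA eqxx mul1r Lplus_Y on_endZ scale_lfunE winZ win_end.
Qed.

Lemma win_GA v a b z : win (Gplus A v) a b z = gateA q (chi n) f g (win v) a b z.
Proof.
rewrite /Defs.Gplus /Fout comp_lfunE win_zdiagA scale_lfunE winZ sum_lfunE win_sum.
rewrite (bigD1 a) //= [X in _ + X]big1 ?addr0 => [|r rb].
  rewrite sum_lfunE win_sum big_ord_recl big_ord1.
  rewrite (_ : lift ord0 ord0 = 1); last exact: val_inj.
  by rewrite (win_termA ord0) (win_termA 1) /gateA -!mulrA mulrCA.
rewrite sum_lfunE win_sum big1 // => s0 _.
by rewrite comp_lfunE win_EA eq_sym (negbTE rb) mul0r.
Qed.
End Window.

(** Displacement 0 suffices because the reference spins s and label n are arbitrary. *)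
Lemma win_inj A B (u v : hilb) : A != B ->
  (forall s n a b, win A B s n u a b 0 = win A B s n v a b 0) -> u = v.
Proof.
move=> AB uv; apply/ffunP=> -[s n]; have := uv s n (s A) (s B).
rewrite /win addr0; have -> // : upd (upd s A (s A)) B (s B) = s.
by apply/ffunP=> i; rewrite !ffunE; do 2 (case: eqP => [->|_] //).
Qed.

Local Notation sz j := (on_site j (sigz R)).
Local Notation hop A B := (op2 A B (bcoef q) (fun _ _ _ _ => 0)).
Local Notation al := ((q - q^-1) / 4).

Lemma itw_Gplus (T : 'End(hilb)) j :
  itw T (on_site j (Fout R Plus eta)) (on_site j (Fout R Plus eta)) ->
  (forall r s, itw T (on_site j (E r s) \o on_end (Lplus R N M r s))%VF
                     (on_site j (E r s) \o on_end (Lplus R N M r s))%VF) ->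
  itw T (Gplus j) (Gplus j).
Proof.
move=> hF hL; have Tl := semilin_lfun T.
apply: itw_comp => //; apply: (itwZ Tl) => //.
by do 2 (apply: (itw_sum Tl) => // ? _).
Qed.

Lemma seam_Gplus A B : A != B ->
  (seam Plus A B \o Gplus B = Gplus B \o hop A B - al *: (sz B \o (Gplus B \o sz B)))%VF.
Proof.
move=> AB; rewrite seamE //.
have wG s n u a b z := @win_GB A B s n u a b z.
(* The gate is generalized, so that only its amplitude formula is kept. *)
move: (Gplus B) wG => G wG; apply/lfunP=> v; apply: (win_inj AB) => s n a b.
rewrite add_lfunE opp_lfunE scale_lfunE winD winN winZ !comp_lfunE.
rewrite win_op2 // win_zdiagB // !wG.
rewrite (@eq_op2f _ _ _ _ _ _ (gateB q (chi n) f g (win A B s n v)));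
  last by move=> *; exact: wG.
rewrite (@eq_gateB _ _ _ _ _ _
  (op2f q (chi n) (bcoef q) (fun _ _ _ _ => 0) (win A B s n v))); last first.
  by move=> *; exact: win_op2.
rewrite (@eq_gateB _ _ _ _ _ (win A B s n (sz B v))
  (fun c d z => diagc 1 (-1) d * win A B s n v c d z)); last first.
  by move=> *; exact: win_zdiagB.
by apply: (gateB_seam g (q_neq0 R N M) (chi_neq0 R M n) (feta_neq0 R eta)).
Qed.

Lemma Gplus_seam A B : A != B ->
  (Gplus A \o seam Plus A B = hop A B \o Gplus A - al *: (sz A \o (Gplus A \o sz A)))%VF.
Proof.
move=> AB; rewrite seamE //.
have wG s n u a b z := @win_GA A B s n AB u a b z.
move: (Gplus A) wG => G wG; apply/lfunP=> v; apply: (win_inj AB) => s n a b.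
rewrite add_lfunE opp_lfunE scale_lfunE winD winN winZ !comp_lfunE.
rewrite [X in _ = X - _]win_op2 // win_zdiagA // !wG.
rewrite (@eq_op2f _ _ _ _ _ _ (gateA q (chi n) f g (win A B s n v)));
  last by move=> *; exact: wG.
rewrite (@eq_gateA _ _ _ _ _ _
  (op2f q (chi n) (kseam q f Plus) (sexp Plus) (win A B s n v))); last first.
  by move=> *; exact: win_op2.
rewrite (@eq_gateA _ _ _ _ _ (win A B s n (sz A v))
  (fun c d z => diagc 1 (-1) c * win A B s n v c d z)); last first.
  by move=> *; exact: win_zdiagA.
by apply: (gateA_seam g (q_neq0 R N M) (chi_neq0 R M n) (feta_neq0 R eta)).
Qed.

Lemma Gplus_site i j (a : 'M[C]_2) : i != j ->
  itw (Gplus j) (on_site i a) (on_site i a).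
Proof.
move=> ij; apply/itw_lfun/esym/itw_lfun; apply: itw_Gplus => [|r s].
  exact/itw_lfun/on_siteC.
by apply: itw_comp; apply/itw_lfun; [exact: on_siteC|exact: on_site_endC].
Qed.

Lemma Gplus_bond i : i != 0 -> i + 1 != 0 -> itw (Gplus 0) (bond i) (bond i).
Proof.
move=> i0 i1; have Gl := semilin_lfun (Gplus 0).
by do ! [apply: (itwD Gl) => // | apply: (itwZ Gl) => // | apply: itw_comp | exact: Gplus_site].
Qed.

Lemma bond_hop i k : i + 1 = k -> bond i = hop i k.
Proof. by case: k /; exact: bondE. Qed.

Lemma transl_ham :
  itw transl (ham Plus) (\sum_(j : 'Z_L | j != 0) bond j + seam Plus 0 1).
Proof.
have Tl := semilin_lfun transl; apply: (itwD Tl) => //.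
  rewrite [X in itw _ _ X](reindex (fun j : 'Z_L => j + 1)) /=; last first.
    by exists (fun j : 'Z_L => j - 1) => j _; ring.
  rewrite [X in itw _ _ X](eq_bigl (fun j : 'Z_L => j != 0 - 1)); last first.
    by move=> j; rewrite sub0r addr_eq0.
  by apply: (itw_sum Tl) => // j _; rewrite !bondE //; exact: transl_op2.
rewrite !seamE ?last_neq0 //.
have := transl_op2 (0 - 1) 0 (kseam q f Plus) (sexp Plus).
by rewrite subrK add0r.
Qed.

Lemma Gplus_ham :
  itw (Gplus 0) (\sum_(j : 'Z_L | j != 0) bond j + seam Plus 0 1) (ham Plus).
Proof.
have Gl := semilin_lfun (Gplus 0); have l0 := last_neq0.
have o0 : (0 : 'Z_L) != 1 by rewrite eq_sym oner_neq0.
pose X := \sum_(j : 'Z_L | (j != 0) && (j != 0 - 1)) bond j.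
have l0' : (0 : 'Z_L) != 0 - 1 by rewrite eq_sym.
have s1 : \sum_(j : 'Z_L | j != 0) bond j = bond (0 - 1) + X by exact: sum_but_left.
have s2 : \sum_(j : 'Z_L | j != 0 - 1) bond j = bond 0 + X by exact: sum_but_right.
have cX : (Gplus 0 \o X = X \o Gplus 0)%VF.
  apply/itw_lfun; apply: (itw_sum Gl) => // i /andP[i0 i1]; apply: Gplus_bond => //.
  by rewrite addr_eq0 -sub0r.
have e1 := seam_Gplus l0; have e2 := Gplus_seam o0.
have b1 : bond (0 - 1) = hop (0 - 1) 0 by apply: bond_hop; rewrite subrK.
have b0 : bond 0 = hop 0 1 by apply: bond_hop; rewrite add0r.
apply/itw_lfun; rewrite /Defs.ham s1 s2 b1 b0.
rewrite comp_lfunDr [in LHS]comp_lfunDr comp_lfunDl [in RHS]comp_lfunDl cX e1 e2.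
(* Site 0 is the second site of the seam (-1, 0) and the first site of (0, 1), so the two defects
   are one operator, occurring once on each side. *)
by rewrite addrACA [RHS]addrACA; congr (_ + _); exact: addrC.
Qed.

Lemma Mplus_ham : itw Mplus (ham Plus) (ham Plus).
Proof. by move=> v; rewrite comp_lfunE transl_ham Gplus_ham -comp_lfunE. Qed.

Lemma comp_scale_cancel (A B : 'End(hilb)) x y : x * y = 1 ->
  ((x *: A) \o (y *: B) = A \o B)%VF.
Proof. by move=> xy; rewrite -comp_lfunZl -comp_lfunZr scalerA xy scale1r. Qed.

Lemma charge_Gplus j : itw charge (Gplus j) (Gplus j).
Proof.
apply: itw_Gplus => [|r s].
  apply: tensor_site; rewrite /gmx /Fout !diag2M; congr diag2; exact: mulrC.
have Cl := semilin_lfun charge.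
have h1 : itw charge (on_site j (E r s)) (omega ^ (r%:Z - s%:Z) *: on_site j (E r s)).
  exact: charge_site.
have h2 : itw charge (on_end (Y (r%:Z - s%:Z) r))
    (omega ^ (- (r%:Z - s%:Z)) *: on_end (Y (r%:Z - s%:Z) r)).
  exact: charge_end.
have := itw_comp h1 h2.
rewrite comp_scale_cancel; last by rewrite -expfzDr ?omega_neq0 // subrr expr0z.
by rewrite Lplus_Y // on_endZ -comp_lfunZr => h; apply: (itwZ Cl).
Qed.

Lemma charge_transl : itw charge transl transl.
Proof.
apply/itw_lfun/esym; rewrite /Defs.transl /Defs.charge.
by rewrite (@site_op_tensor R N L _ (fun j => j + 1)) //; [exact: subrK|exact: addrK].
Qed.

Lemma charge_Mplus : itw charge Mplus Mplus.
Proof. by apply: itw_comp; [exact: charge_Gplus|exact: charge_transl]. Qed.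

(** * Action of C and Theta on the charge *)

Lemma tensorZ a x (y : endM) : tensor (L := L) a (x *: y) = x *: tensor a y.
Proof.
apply/lfunP=> v; apply/ffunP=> b; rewrite scale_lfunE ffunE !mxopE scaler_sumr.
by apply: eq_bigr => c _; rewrite mxE -[_ *: _]/(_ * _); ring.
Qed.

Lemma tensor_scale a x (y : endM) :
  tensor (fun j => x *: a j) y = x ^+ (Zp_trunc L).+2 *: tensor (L := L) a y.
Proof.
apply/lfunP=> v; apply/ffunP=> b; rewrite scale_lfunE ffunE !mxopE scaler_sumr.
apply: eq_bigr => c _; under eq_bigr do rewrite mxE.
by rewrite big_split prodr_const card_ord -[_ *: _]/(_ * _) -!mulrA.
Qed.

Lemma ZinvE : Z R N M ^ (-1) = Y 0 (-1).
Proof. by rewrite /Defs.Y expr0z mul1r. Qed.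

(** Reflection permutes equal factors g, and the diagonal factors commute with g and Z; only
    X^(-L-1) contributes, through Z^(-1). *)
Lemma Cop_charge : itw Cop charge (omega ^ (- (L%:Z + 1)) *: charge).
Proof.
rewrite CopE; apply/itw_lfun; rewrite -comp_lfunA /Defs.charge.
rewrite (@site_op_tensor R N L _ (fun j => - 1 - j)); try by move=> i; rewrite subKr.
rewrite comp_lfunA -comp_lfunZl comp_lfunA !tensor_comp ZinvE XP_Y //.
have -> z : omega ^ z = q ^ (2 * z) by rewrite -exprz_exp.
rewrite tensorZ -comp_lfunZl (_ : 0 * _ - _ = 2 * - (L%:Z + 1)); last by ring.
rewrite (@eq_tensor R N L _ (fun j => gmx R N M * Cdiag j)) // => j.
by rewrite /Cdiag /gmx /Fout /qsz !diag2M; congr diag2; exact: mulrC.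
Qed.

Lemma map_diag2 x y : map_mx Num.conj (diag2 x y) = diag2 x^* y^* :> 'M[C]_2.
Proof.
apply/matrixP=> i j; rewrite !mxE rmorphMn /=.
by case: (eqVneq i j) => [->|_] //; case: (j == 0).
Qed.

Lemma sigx_diag2 x y : sigx R * diag2 x y = diag2 y x * sigx R.
Proof. by rewrite /sigx mulrDl mulrDr !E_diag2 !diag2_E. Qed.

Lemma scale_diag2 z x y : z *: diag2 x y = diag2 (z * x) (z * y) :> 'M[C]_2.
Proof. by apply/matrixP=> i j; rewrite !mxE mulrnAr; case: (i == 0). Qed.

(** Complex conjugation and spin flip turn g into g / omega on each of the L sites; X^kappa
    contributes chi kappa through Z^(-1). *)
Lemma Theta_charge : itw Theta charge ((omega ^ (- L%:Z) * chi (kappa M eta)) *: charge).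
Proof.
move=> v; rewrite /Defs.Theta Kop_tensor scale_lfunE -!comp_lfunE !tensor_comp ZinvE.
rewrite XJ_Y // opprK expr1z oppr0.
have gs : sigx R * map_mx Num.conj (gmx R N M) = omega^-1 *: (gmx R N M * sigx R).
  rewrite map_diag2 sigx_diag2 scalerAl scale_diag2 conjC1 conj_omega mulr1.
  by rewrite mulVf // omega_neq0.
rewrite (@eq_tensor R N L _ (fun j => omega^-1 *: (gmx R N M * sigx R))) //.
rewrite tensorZ tensor_scale scalerA scale_lfunE mulrC; congr (_ * _ *: _).
by rewrite Zp_cast ?(ltnW L_ge3) // exprVn exprnN.
Qed.

(** * Unitarity of the factors *)

Lemma half_gate : g^* * g * 2 = 1.
Proof.
have -> : g^* = g by rewrite fmorphV; congr (_^-1); exact: conjc_real.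
have n0 : (Num.sqrt 2)%:C%C != 0 :> C.
  by rewrite -(rmorph0 (real_complex R)) (inj_eq (@complexI R)) sqrtr_eq0 -ltNge ltr0n.
have -> : 2 = (Num.sqrt 2)%:C%C * (Num.sqrt 2)%:C%C :> C.
  by rewrite -rmorphM -expr2 sqr_sqrtr ?ler0n // rmorph_nat.
by rewrite mulrACA mulVf // mulr1.
Qed.

Definition Wplus j : 'End(hilb) :=
  g *: \sum_r \sum_s (on_site j (E r s) \o on_end (Lplus R N M r s))%VF.

Lemma adj_Wplus j : adj (Wplus j) =
  g^* *: \sum_r \sum_s (on_site j (E s r) \o on_end (dag (Lplus R N M r s)))%VF.
Proof.
rewrite adjopZ adj_sum; congr (_ *: _); apply: eq_bigr => r _.
rewrite adj_sum; apply: eq_bigr => s _.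
by rewrite adj_comp adj_on_site adj_on_end dagE on_site_endC.
Qed.

Ltac eval_Y := repeat match goal with
  | |- context [Defs.Y R N M ?a ?b] =>
    let a' := eval vm_compute in a in let b' := eval vm_compute in b in
    progress change (Defs.Y R N M a b) with (Defs.Y R N M a' b')
  end.

(** The block columns of L_+ are orthogonal: for s != t the two products are opposite multiples of
    one monomial in X and Z, and for s = t both are the identity. *)
Lemma Lplus_unitary s t :
  \sum_r dag (Lplus R N M r s) * Lplus R N M r t = ((s == t)%:R * 2) *: 1.
Proof.
have dagZ x (y : endM) : dag (x *: y) = x^* *: dag y.
  by apply/matrixP=> i j; rewrite !mxE rmorphM.
have q0 := q_neq0 R N M.
rewrite big_ord_recl big_ord1 (_ : lift ord0 ord0 = 1); last exact: val_inj.
rewrite !Lplus_Y // !dagZ !dagY // -!scalerAl -!scalerAr !YM // !scalerA.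
have cq2 : (q ^+ 2)^* = q ^- 2 by rewrite rmorphXn /= conj_q exprVn.
have cNq : (- q)^* = - q^-1 by rewrite rmorphN /= conj_q.
move: s t; do 2 (apply: ord2_ind); rewrite /lcoef /= ?cq2 ?cNq ?conj_q ?conjC1.
all: eval_powers; eval_Y.
- by rewrite -scalerDl -[Defs.Y _ _ _ _ _]/(Y 0 0) Y00; congr (_ *: _); rewrite /Defs.omega; field.
- by rewrite -scalerDl (_ : _ + _ = 0) ?mul0r ?scale0r // /Defs.omega; field.
- by rewrite -scalerDl (_ : _ + _ = 0) ?mul0r ?scale0r // /Defs.omega; field.
by rewrite -scalerDl -[Defs.Y _ _ _ _ _]/(Y 0 0) Y00; congr (_ *: _); rewrite /Defs.omega; field.
Qed.

Lemma on_site0 j : on_site j 0 = 0.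
Proof. by rewrite -[0 in LHS](scale0r (0 : 'M[C]_2)) on_siteZ scale0r. Qed.

Lemma on_end_sum (F : 'I_2 -> endM) v : on_end (\sum_i F i) v = \sum_i on_end (F i) v.
Proof.
apply/ffunP=> -[s n]; rewrite sum_ffunE on_endE; under [RHS]eq_bigr do rewrite on_endE.
rewrite exchange_big; apply: eq_bigr => m _.
by rewrite summxE mulr_suml.
Qed.

Lemma on_endM (y z : endM) : (on_end y \o on_end z = on_end (y * z))%VF.
Proof. by rewrite /Defs.on_end tensor_comp; apply: eq_tensor => i; rewrite mulr1. Qed.

Local Notation W0 j := (\sum_r \sum_s (on_site j (E r s) \o on_end (Lplus R N M r s)))%VF.
Local Notation W1 j := (\sum_r \sum_s (on_site j (E s r) \o on_end (dag (Lplus R N M r s))))%VF.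

Lemma site_Wsum j s r v :
  on_site j (E s r) (W0 j v) = \sum_t on_site j (E s t) (on_end (Lplus R N M r t) v).
Proof.
rewrite sum_lfunE linear_sum (bigD1 r) //= [X in _ + X]big1 ?addr0 => [|r' rr].
  rewrite sum_lfunE linear_sum; apply: eq_bigr => t _.
  by rewrite /= comp_lfunE -[LHS]comp_lfunE on_siteM [E s r * _]mul_delta_mx.
rewrite sum_lfunE linear_sum big1 // => t _.
rewrite /= comp_lfunE -[LHS]comp_lfunE on_siteM [E s r * _]mul_delta_mx_0 1?eq_sym //.
by rewrite on_site0 zero_lfunE.
Qed.

Lemma Wplus_sums j v : W1 j (W0 j v) = 2 *: v.
Proof.
transitivity (\sum_r \sum_s \sum_t
    on_site j (E s t) (on_end (dag (Lplus R N M r s) * Lplus R N M r t) v)).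
  rewrite sum_lfunE; apply: eq_bigr => r _; rewrite sum_lfunE; apply: eq_bigr => s _.
  rewrite on_site_endC comp_lfunE site_Wsum linear_sum; apply: eq_bigr => t _.
  by rewrite /= -comp_lfunE -on_site_endC comp_lfunE -on_endM comp_lfunE.
rewrite exchange_big.
transitivity (\sum_s 2 *: on_site j (E s s) v).
  apply: eq_bigr => s _; rewrite exchange_big (bigD1 s) //= [X in _ + X]big1 ?addr0 => [|t st].
    rewrite -linear_sum -on_end_sum Lplus_unitary eqxx mul1r on_endZ on_end1.
    by rewrite scale_lfunE id_lfunE linearZ.
  rewrite -linear_sum -on_end_sum Lplus_unitary eq_sym (negbTE st) mul0r on_endZ.
  by rewrite scale0r zero_lfunE linear0.
rewrite big_ord_recl big_ord1 (_ : lift ord0 ord0 = 1); last exact: val_inj.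
rewrite -scalerDr -add_lfunE -on_siteD (_ : _ + _ = 1).
  have -> : on_site j 1 = \1%VF; last by rewrite id_lfunE.
  by rewrite -tensor1; apply: eq_tensor => i; case: eqP.
by apply/matrixP; do 2 (apply: ord2_ind); rewrite !mxE ?addr0 ?add0r.
Qed.

Lemma unitary_Wplus j : unitary (Wplus j).
Proof.
apply/eqP/lfunP=> v; rewrite adj_Wplus comp_lfunE !scale_lfunE linearZ /= Wplus_sums.
by rewrite !scalerA half_gate scale1r id_lfunE.
Qed.

Lemma unitary_diag2 x y : x^* * x = 1 -> y^* * y = 1 ->
  dag (diag2 x y) * diag2 x y = 1 :> 'M[C]_2.
Proof. by move=> hx hy; rewrite dag_diag2 diag2M hx hy diag2_1. Qed.

Lemma dag_Fout : dag (Fout R Plus eta) * Fout R Plus eta = 1.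
Proof. by apply: unitary_diag2; rewrite ?conjC1 ?mul1r // conj_feta mulVf ?feta_neq0. Qed.

Lemma unitary_Gplus j : unitary (Gplus j).
Proof.
apply: unitary_comp; last exact: unitary_Wplus.
apply: tensor_unitary => [i|]; rewrite ?dag1 ?mulr1 //.
by case: eqP; rewrite ?dag_Fout ?dag1 ?mulr1.
Qed.

Lemma unitary_Mplus : unitary Mplus.
Proof.
apply: unitary_comp; first exact: unitary_Gplus.
by apply: (site_op_unitary R N (t' := fun j => j + 1)); [exact: subrK|exact: addrK].
Qed.

Lemma unitary_Cop : unitary Cop.
Proof.
rewrite CopE; apply: unitary_comp; last first.
  by apply: (site_op_unitary R N (t' := fun j => - 1 - j)) => j; rewrite subKr.
have u1 (t : R) : (cis t)^* * cis t = 1 by rewrite conj_cis mulVf ?cis_neq0.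
apply: tensor_unitary => [j|].
  rewrite /Cdiag /Fout /qsz diag2M; apply: unitary_diag2; rewrite rmorphM /=.
    by rewrite conjC1 !mul1r u1.
  by rewrite mulrACA u1 conj_feta mulVf ?feta_neq0 ?mulr1.
apply/matrixP=> m n; rewrite [LHS]mxE.
under eq_bigr do rewrite 2!mxE !XPE rmorphM /= conjC_nat mulrCA -mulrA.
rewrite (eq_bigr (fun i => (i == n + (- L%:Z - 1)%:~R)%:R *
  ((m == n)%:R * ((ph R M m)^* * ph R M n)))).
  rewrite sum_delta mxE; case: eqP => [->|]; last by rewrite mul0r.
  by rewrite mul1r conj_ph // mulVf ?ph_neq0.
move=> i _; case: (eqVneq i (n + (- L%:Z - 1)%:~R)) => [->|_]; last by rewrite !mul0r.
by rewrite (inj_eq (addIr _)) eq_sym; ring.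
Qed.

Lemma antiunitary_Theta : antiunitary Theta.
Proof.
apply: antiunitary_comp_l; last exact: antiunitary_Kop.
apply: tensor_unitary => [j|].
  apply/matrixP=> a b; rewrite mxE; under eq_bigr do rewrite 2!mxE !sigxE conjC_nat.
  by rewrite sum_delta mxE (inj_eq rev_ord_inj).
apply/matrixP=> m n; rewrite mxE; under eq_bigr do rewrite 2!mxE !XJE conjC_nat.
by rewrite sum_delta mxE (inj_eq (addrI _)) eqr_opp eq_sym.
Qed.

(** * The symmetry B *)

Lemma antiunitary_Bop s r : antiunitary (Bop s r).
Proof.
have uM : unitary (lfun_exp Mplus r) by apply: unitary_exp; exact: unitary_Mplus.
have uC : unitary Cop by exact: unitary_Cop.
have aA : antiunitary (fun v => lfun_exp Mplus r (Cop (Theta v))).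
  exact/antiunitary_comp_l/antiunitary_comp_l/antiunitary_Theta.
case: s => //; apply: (antiunitary_comp_l (unitary_adj uC)).
exact: (antiunitary_comp_r uC aA).
Qed.

Lemma itw_adj (U A B : 'End(hilb)) : unitary U -> itw U A B -> itw (adj U) B A.
Proof.
move=> uU h v; apply: (can_inj (unitaryK uU)).
by rewrite unitaryKV // h unitaryKV.
Qed.

Lemma itw_exp (T A : 'End(hilb)) r : unitary T -> itw T A A -> itw (lfun_exp T r) A A.
Proof. by move=> uT /itw_lfun h; apply/itw_lfun/commute_exp. Qed.

Lemma Bop_ham s r : itw (Bop s r) (ham s) (ham s).
Proof.
have uC : unitary Cop by exact: unitary_Cop.
have CH : itw Cop (ham Minus) (ham Plus) by exact: Cop_ham.
have TH : itw Theta (ham Plus) (ham Minus) by exact: Theta_ham.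
have MH : itw (lfun_exp Mplus r) (ham Plus) (ham Plus).
  by apply: itw_exp; [exact: unitary_Mplus|exact: Mplus_ham].
case: s => v /=; first by rewrite /Aop TH CH MH.
by rewrite /Aop CH TH CH MH (itw_adj uC CH).
Qed.

Lemma lfunZ (A : 'End(hilb)) x v : A (x *: v) = x *: A v.
Proof. exact: linearZ. Qed.

(** In the plus branch Theta and C give omega to the power kappa - L - (L + 1), and M commutes with
    the charge. In the minus branch the inner C, conjugated by Theta, and the outer adjoint of C
    each add L + 1, leaving kappa + 1. *)
Lemma Bop_charge s r :
  itw (Bop s r) charge (chi (- csec M L eta s) *: charge).
Proof.
have uC : unitary Cop by exact: unitary_Cop.
have CQ : itw Cop charge (omega ^ (- (L%:Z + 1)) *: charge) by exact: Cop_charge.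
have TQ : itw Theta charge ((omega ^ (- L%:Z) * chi (kappa M eta)) *: charge).
  exact: Theta_charge.
have MQ : itw (lfun_exp Mplus r) charge charge.
  apply: itw_exp; first exact: unitary_Mplus.
  by apply/itw_lfun/esym/itw_lfun/charge_Mplus.
have o0 := omega_neq0 R N M.
have AQ v : lfun_exp Mplus r (Cop (Theta (charge v))) =
    (omega ^ (- L%:Z) * chi (kappa M eta) * omega ^ (- (L%:Z + 1))) *:
      charge (lfun_exp Mplus r (Cop (Theta v))).
  by rewrite TQ scale_lfunE !lfunZ CQ scale_lfunE lfunZ MQ scalerA.
have ThetaZ (x : C) v : Theta (x *: v) = x^* *: Theta v.
  have := semilin_Theta x v 0.
  rewrite addr0 => ->; rewrite [Theta 0](_ : _ = 0) ?addr0 //.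
  by apply: (semilin0 (semilin_Theta)); exact: conjC1.
case: s => v; rewrite scale_lfunE.
  rewrite /= /Aop AQ; congr (_ *: _); rewrite /csec opprB chiD // chiN // chiE // exprnN.
  by rewrite mulrAC -expfzDr // mulrC; congr (_ * _ ^ _); lia.
rewrite /= /Aop CQ scale_lfunE ThetaZ !lfunZ AQ !lfunZ.
have adjQ u : adj Cop (charge u) = omega ^ (L%:Z + 1) *: charge (adj Cop u).
  have := itw_adj uC CQ u; rewrite scale_lfunE lfunZ => <-.
  by rewrite scalerA -expfzDr // subrr expr0z scale1r.
rewrite adjQ !scalerA; congr (_ *: _).
have -> : (omega ^ (- (L%:Z + 1)))^* = omega ^ (L%:Z + 1).
  by rewrite conjCXz conj_omega exprz_inv opprK.
have -> : - csec M L eta Minus = kappa M eta + 1%:R by rewrite /csec opprB opprK.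
rewrite chiD // chiE // expr1.
have e1 : omega ^ (L%:Z + 1) = omega ^+ L * omega by rewrite expfzDr.
have -> : omega ^ (- (L%:Z + 1)) = (omega ^+ L * omega)^-1 by rewrite -invr_expz e1.
rewrite e1 -exprnN; have := expf_neq0 L o0; move: (omega ^+ L) => w w0.
by field; rewrite w0 o0.
Qed.

Lemma mem_sector (m : 'Z_N) v : (v \in sector R M L m) = (charge v == chi m *: v).
Proof. by rewrite memv_ker add_lfunE opp_lfunE scale_lfunE id_lfunE subr_eq0. Qed.

(** Antilinearity conjugates the eigenvalue, so m becomes -m, and the scalar chi (- c) in the
    intertwining relation shifts this by c. *)
Lemma antilinear_sector (T : hilb -> hilb) (c m : 'Z_N) v :
  (forall a u, T (a *: u) = a^* *: T u) -> injective T ->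
  itw T charge (chi (- c) *: charge) ->
  (T v \in sector R M L (c - m)) = (v \in sector R M L m).
Proof.
move=> TZ Tinj TQ; have := TQ v; rewrite scale_lfunE !mem_sector => TQv.
have c1 : chi (c - m) = chi c * (chi m)^-1 by rewrite chiD // chiN.
have c0 := chi_neq0 R M c; rewrite chiN // in TQv.
apply/eqP/eqP => h.
  apply: Tinj; rewrite TQv h TZ scalerA c1 mulrA mulVf // mul1r.
  by rewrite conj_chi.
apply: (scalerI (invr_neq0 c0)).
rewrite -TQv h TZ scalerA c1 mulrA mulVf // mul1r.
by rewrite conj_chi.
Qed.
End Model.

(** * Symmetry, sectors and spectra *)

Local Open Scope classical_set_scope.

Theorem theorem5p2 (R : realType) (N M L : nat)
    (N_ge2 : (2 <= N)%N) (M_ge1 : (1 <= M)%N) (M_ltN : (M < N)%N)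
    (coMN : coprime M N) (L_ge3 : (3 <= L)%N)
    (eta : 'Z_(2 * N)) (r : int) (s : branch) :
  let B : hilb R N L -> hilb R N L := @Bop R N M L eta s r in
  let H : 'End(hilb R N L) := @ham R N M L eta s 0 in
  let c : 'Z_N := @csec N M L eta s in
  [/\ antiunitary B,
      (forall Binv : hilb R N L -> hilb R N L,
         cancel B Binv -> cancel Binv B -> B \o H \o Binv =1 H),
      (forall m : 'Z_N,
         B @` [set` sector R M L m] = [set` sector R M L (c - m)])
    & (forall m : 'Z_N, m != c - m ->
         lchar_poly (lrestrict (sector R M L m) H) =
         lchar_poly (lrestrict (sector R M L (c - m)) H))].
Proof.
move=> B H c.
have aB : antiunitary B by exact: antiunitary_Bop.
have BH : itw B H H by exact: Bop_ham.
have BQ : itw B (charge R N M L) (chi R M (- c) *: charge R N M L) by exact: Bop_charge.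
have QH : itw (charge R N M L) H H by exact: charge_ham.
have adjH : adj H = H by exact: adj_ham.
(* From here on only the properties just collected are used, whatever the branch. *)
clearbody B H c; have [Bl [B' B'K BK'] Bi] := aB.
have B0 : B 0 = 0 by apply: (semilin0 Bl); exact: conjC1.
have Bs m v : (B v \in sector R M L (c - m)) = (v \in sector R M L m).
  apply: antilinear_sector => //; last exact: (can_inj B'K).
  by move=> a u; have := Bl a u 0; rewrite B0 !addr0.
split; first exact: aB.
- by move=> Binv _ BK v; rewrite /= BH BK.
- move=> m; apply/seteqP; split=> [_ [v vm <-]|v vm] /=; first by rewrite Bs.
  by exists (B' v); [rewrite -Bs BK'; exact: vm|exact: BK'].
move=> m _.
have HU m' v : v \in sector R M L m' -> H v \in sector R M L m'.
  by rewrite !mem_sector QH => /eqP ->; rewrite lfunZ.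
have positive (v : hilb R N L) : inner v v = 0 -> v = 0.
  move=> v0; apply/ffunP=> b; rewrite [RHS]ffunE; apply/eqP.
  have : `|v b| ^+ 2 == 0.
    rewrite normCKC; move/eqP: v0; rewrite psumr_eq0 => [/allP/(_ b)|? _].
      by rewrite mem_index_enum; exact.
    by rewrite mulrC mul_conjC_ge0.
  by rewrite sqrf_eq0 normr_eq0.
(* B is antilinear and [inner] is conjugate-linear on the left, so this form is bilinear. *)
apply: (@pairing_lchar_poly _ _ _ _ _ (fun u w => inner (B u) w)).
- exact: HU.
- exact: HU.
- by move=> w a u v; rewrite Bl innerDl innerZl conjCK.
- by move=> w a u v; rewrite innerDr innerZr.
- by move=> u w; rewrite BH adjopP adjH.
(* The test vector is B u itself, which lies in the sector c - m; positivity gives B u = 0. *)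
- move=> u um h; apply: (can_inj B'K); rewrite B0.
  by apply/positive/h; rewrite Bs.
(* The test vector is the preimage of w under B, which lies in the sector m. *)
move=> w wm h; apply: positive.
by rewrite -{1}(BK' w); apply: h; rewrite -Bs BK'.
Qed.
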